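(* Suppose that $\alpha>1$ and $\kappa\in(1/2,1]$ satisfy $\alpha>\frac{\kappa}{3\kappa+4}+5\kappa+\frac72$. Then for any $t>0$, $f\in\mathrm{BL}^\kappa$, $K\in(0,\infty)$ and $E<\frac{\kappa}{2(3\kappa+4)}$, $$\mathbb E\left[\sup_{|x|\le K}\left|E_x[f(X_t)]-E^n_{\frac{\lfloor nx\rfloor}{n}}[f(X^n_t)]\right|\right]\lesssim\|f\|_{\mathrm{BL}^\kappa}\,n^{-E}.$$
   Context: One-dimensional Bouchaud trap model. $(\tau_x)_{x\in\mathbb Z}$ are i.i.d. random variables on a probability space with probability $\mathbb P$ and expectation $\mathbb E$, with $\mathbb P(\tau_0\ge u)=u^{-\alpha}$ for $u>1$. For a realization of $(\tau_x)$, put $\mu_n=\frac1n\sum_{x\in\mathbb Z}\tau_x\delta_{x/n}$ on $n^{-1}\mathbb Z$ and $\mu=\mathbb E[\tau_0]\,dx$ on $\mathbb R$. $X^n=(X^n_t)$, with expectation $E^n_a$ (for fixed $(\tau_x)$) when started from $a\in n^{-1}\mathbb Z$, is the Markov process associated with $n^{-1}\mathbb Z$ equipped with the Euclidean metric (as resistance metric) and $\mu_n$, i.e. the continuous-time chain with generator $\Delta_nf(x/n)=\frac{n^2}{\tau_x}\sum_{y:|y-x|=1}(f(y/n)-f(x/n))$. $X=(X_t)$, with expectation $E_a$ when started from $a$, is the process associated with $\mathbb R$ with the Euclidean metric and $\mu$, i.e. the diffusion with generator $\frac1{\mathbb E[\tau_0]}\frac{d^2}{dx^2}$. $\|f\|_{\mathrm{BL}^\kappa}=\sup_{\mathbb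 R}|f|+\sup_{x\ne y}|f(x)-f(y)|/|x-y|^\kappa$, and $\mathrm{BL}^\kappa$ is the set of $f:\mathbb R\to\mathbb R$ with finite norm. $\lesssim$ means inequality for all $n\ge1$ up to a deterministic constant in $(0,\infty)$ independent of $n$ and $f$ (it may depend on $\alpha,\kappa,t,K,E$). *)

(* Defs.v *)
From HB Require Import structures.
From mathcomp Require Import all_boot all_order all_algebra.
From mathcomp Require Import all_classical all_reals all_analysis.
From mathcomp Require Import measurable_realfun.

Set Implicit Arguments.
Unset Strict Implicit.
Unset Printing Implicit Defensive.

Import Order.TTheory GRing.Theory Num.Theory.
Import numFieldNormedType.Exports.

Local Open Scope classical_set_scope.
Local Open Scope ring_scope.

Definition mutually_independent (R : realType) (I : eqType)
    (d : measure_display) (Omega : measurableType d)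
    (P : probability Omega R) (Y : I -> {RV P >-> R}) : Prop :=
  forall (s : seq I) (B : I -> set R), uniq s ->
    (forall i, measurable (B i)) ->
    P [set w | forall i, i \in s -> B i (Y i w)] =
    (\prod_(i <- s) P [set w | B i (Y i w)])%E.

Definition identically_distributed (R : realType) (I : Type)
    (d : measure_display) (Omega : measurableType d)
    (P : probability Omega R) (Y : I -> {RV P >-> R}) : Prop :=
  forall (i j : I) (B : set R), measurable B ->
    P [set w | B (Y i w)] = P [set w | B (Y j w)].

Definition iid_pareto (R : realType) (alpha : R)
    (d : measure_display) (Omega : measurableType d)
    (P : probability Omega R) (tau : int -> {RV P >-> R}) : Prop :=
  [/\ mutually_independent tau, identically_distributed tau &
      forall u : R, 1 < u -> P [set w | u <= tau 0 w] = (u `^ (- alpha))%:E].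

(* The events of sigma(X_u : 0 <= u <= s). *)
Definition past (R : realType) (T : Type) (X : R -> T -> R) (s : R) :
    set (set T) :=
  <<s [set A | exists (u : R) (B : set R),
        [/\ 0 <= u, u <= s, measurable B & A = X u @^-1` B] ] >>.

(* A conservative Markov process with cadlag paths in a state space S: one
   sample space carrying the path and, for each a in S, a law [mp_law a] under
   which the process starts from a. The laws [mp_law a] with a outside S, and
   [mp_path t] with t < 0, are irrelevant. *)
Record markov_process (R : realType) (S : set R) := MarkovProcess {
  mp_display : measure_display ;
  mp_space : measurableType mp_display ;
  mp_law : R -> probability mp_space R ;
  mp_path : R -> mp_space -> R ;
  mp_measurable : forall t : R, 0 <= t -> measurable_fun setT (mp_path t) ;
  mp_state : forall (t : R) w, 0 <= t -> S (mp_path t w) ;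
  mp_right_continuous : forall (t : R) w, 0 <= t ->
    mp_path s w @[s --> t^'+] --> mp_path t w ;
  mp_left_limits : forall (t : R) w, 0 < t ->
    cvg (mp_path s w @[s --> t^'-] : set_system R) ;
  mp_start : forall a : R, S a -> mp_law a [set w | mp_path 0 w = a] = 1%E ;
  mp_kernel : forall A : set mp_space, measurable A ->
    measurable_fun S (fun a : R => mp_law a A) ;
  mp_markov : forall (a s t : R) (A : set mp_space) (g : R -> R),
    S a -> 0 <= s -> 0 <= t -> past mp_path s A ->
    measurable_fun setT g -> (exists M : R, forall y : R, `|g y| <= M) ->
    (\int[mp_law a]_(w in A) (g (mp_path (s + t) w))%:E =
     \int[mp_law a]_(w in A) 'E_(mp_law (mp_path s w))[g \o mp_path t])%E
}.

Arguments mp_law {R S} X a : rename.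
Arguments mp_path {R S} X t w : rename.

(* E_a[f(X_t)] *)
Definition mp_expect (R : realType) (S : set R) (X : markov_process S)
    (a t : R) (f : R -> R) : \bar R :=
  'E_(mp_law X a)[f \o mp_path X t].

(* L is the infinitesimal generator of X on the class D of test functions:
   (E_a[g(X_h)] - g(a)) / h --> L g(a) as h decreases to 0, uniformly in a. *)
Definition has_generator (R : realType) (S : set R) (X : markov_process S)
    (D : set (R -> R)) (L : (R -> R) -> (R -> R)) : Prop :=
  forall g, D g -> forall e : R, 0 < e ->
    \forall h \near 0^'+, forall a, S a ->
      `|(fine (mp_expect X a h g) - g a) / h - L g a| <= e.

Definition bounded_support (R : realType) (g : R -> R) : Prop :=
  exists M : R, forall x : R, M < `|x| -> g x = 0.

Definition C2 (R : realType) (g : R -> R) : Prop :=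
  [/\ forall x : R, derivable g x 1, forall x : R, derivable (derive1 g) x 1 &
      continuous (derive1n 2 g)].

(* The diffusion on the line with generator c d^2/dx^2. *)
Definition is_diffusion (R : realType) (c : R)
    (X : markov_process [set: R]) : Prop :=
  (forall w, {within `[0, +oo[, continuous (fun t => mp_path X t w)}) /\
  has_generator X [set g | C2 g /\ bounded_support g]
    (fun g x => c * derive1n 2 g x).

Definition lattice (R : realType) (n : nat) : set R :=
  [set x%:~R / n%:R | x in [set: int]].
Arguments lattice R n : clear implicits.

(* Delta_n f (x/n) = n^2 / tau_x * sum_(|y - x| = 1) (f (y/n) - f (x/n)), as a
   function of a = x/n, for which Num.floor (n * a) = x. *)
Definition trap_generator (R : realType) (n : nat) (tau : int -> R)
    (f : R -> R) (a : R) : R :=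
  let x : int := Num.floor (n%:R * a) in
  n%:R ^+ 2 / tau x *
    \sum_(y <- [:: x - 1; x + 1]) (f (y%:~R / n%:R) - f (x%:~R / n%:R)).

(* The chain on the lattice with generator Delta_n, for fixed traps. On the
   discrete state space it is enough to test finitely supported functions:
   being non-explosive, the chain is determined by its jump rates. *)
Definition is_trap_chain (R : realType) (n : nat) (tau : int -> R)
    (X : markov_process (lattice R n)) : Prop :=
  has_generator X [set g | bounded_support g] (trap_generator n tau).

Definition BLnorm (R : realType) (kappa : R) (f : R -> R) : \bar R :=
  (ereal_sup [set `|f x|%:E | x in [set: R]] +
   ereal_sup [set (`|f p.1 - f p.2| / `|p.1 - p.2| `^ kappa)%:E |
               p in [set p : R * R | p.1 != p.2]])%E.

Definition BL (R : realType) (kappa : R) : set (R -> R) :=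
  [set f | (BLnorm kappa f < +oo)%E].

(* Main.v *)
Require Import Defs.
From HB Require Import structures.
From mathcomp Require Import all_boot all_order all_algebra.
From mathcomp Require Import all_classical all_reals all_analysis.
From mathcomp Require Import measurable_realfun.
From mathcomp Require Import ring lra zify.

(** Both semigroups are compared with the powers of one explicit operator, a step
[Q g (x) = (g (x + r) + g (x - r)) / 2] of a symmetric walk on the line, where
[r ^ 2 = 2 c h], [c = 1 / E (tau_0)], and [h] is a time step that tends to [0].
This operator commutes with derivatives and contracts the supremum norm. Hence,
if [v] is a smooth approximation of [f], all the iterates [v_j = Q ^ j v] keep
the derivative bounds of [v]. They play the part of the heat semigroup.

For the diffusion, the generator gives
[T_h v_j = v_j + h c v_j'' + O(h ^ 2)], and [Q v_j] has the same expansion, up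
to [O(h ^ (3/2))]. Telescoping over the [t / h] steps and letting [h] tend to [0]
identifies [T_t v] as the limit of the iterates ([diffusion_walk]).

For the chain, the generator applied to [v_j] is close to [v_j'' / tau_x], which
fluctuates from site to site and only averages to [c v_j''] over many sites. This
is repaired by a corrector ([corrector]): with [psi_j] solving
[n ^ 2 Delta psi_j = (c tau - 1) v_j''], the generator applied to [v_j + psi_j]
is close to [c v_j''] ([corrected_generator]). As the noise [c tau - 1] is
centred, orthogonal and square integrable, its first primitive at a distance [u]
from the origin has a mean size of order
[sqrt (u / n) sup |v_j''|], and the corrector, being
bounded by the sum of the absolute values of its gradient, is at most
[Z (1 + x ^ 2)] at all sites simultaneously, with [E Z] of order
[n ^ (-1/2) sup |v_j''|] ([corrector_bound], [mean_corrector_size]). The growth in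
[x] is harmless because the chain, in traps that are all at least [1], satisfies
[E_a (1 + X_s ^ 2) <= 1 + a ^ 2 + C s] ([chain_weight]). In the telescoping sum
([chain_walk]) the correctors appear through [psi_0], through the last one, and
through the increments [psi_j - psi_(j+1)], which are the correctors of
[v_j'' - v_(j+1)'' = O(h v'''')]; the latter add up to
[O(t n ^ (-1/2) sup |v''''|)].

If [f] has norm [L] and is mollified at scale [delta], then [v] is within
[O(L delta ^ kappa)] of [f], and its [j]-th derivative is at most of order
[L delta ^ (kappa - j)] ([mollification]). With [delta = n ^ (-1/11)] the factor
[n ^ (-1/2) delta ^ -4] is at most [1], and the total error is of order
[L delta ^ kappa = L n ^ (- kappa / 11)] ([sup_expect_mean]). As
[kappa >= 1/2], this is at most [L n ^ -E] for all [E] below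
[kappa / (2 (3 kappa + 4))]. Test functions of the generators have bounded support,
so [f] and the correctors are cut off; the radii, like [h], are free parameters
whose cost is made as small as desired. *)

Set Implicit Arguments.
Unset Strict Implicit.
Unset Printing Implicit Defensive.

Import Order.TTheory GRing.Theory Num.Theory.
Import numFieldNormedType.Exports.

Local Open Scope classical_set_scope.
Local Open Scope ring_scope.

(** * The semigroup of a Markov process *)

(** The integral is built from suprema over the simple functions below the
positive and negative parts, so it is monotone on arbitrary functions. This
covers the supremum over starting points in the theorem, and lets one integrate
[fun w => mp_expect X (mp_path X s w) h g] between bounds that are measurable. *)
Lemma le_integral_any (R : realType) (d : measure_display)
    (T : measurableType d) (mu : {measure set T -> \bar R}) (f g : T -> \bar R) :
  (forall x, (f x <= g x)%E) -> (\int[mu]_x f x <= \int[mu]_x g x)%E.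
Proof.
move=> fg; rewrite /integral !patch_setT.
apply: leeB; apply: le_ereal_sup => _ [h /= hle <-]; exists h => // x;
  apply: (le_trans (hle x)).
- by rewrite !funeposE ge_max !le_max lexx orbT andbT (fg x).
- by rewrite !funenegE ge_max !le_max lexx orbT andbT leeN2 (fg x).
Qed.

Section markov_semigroup.
Context {R : realType} {S : set R} (X : markov_process S).

Definition nice (g : R -> R) : Prop :=
  measurable_fun setT g /\ exists M : R, forall y, `|g y| <= M.

Definition semigroup (s : R) (g : R -> R) (a : R) : R :=
  fine (mp_expect X a s g).

Local Notation T := semigroup.

Lemma nice_cst (k : R) : nice (cst k).
Proof. by split; [exact: measurable_cst|exists `|k|]. Qed.

Lemma niceD f g : nice f -> nice g -> nice (f \+ g).
Proof.
move=> [mf [M hM]] [mg [N hN]]; split; first exact: measurable_funD.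
by exists (M + N) => y; rewrite (le_trans (ler_normD _ _))// lerD.
Qed.

Lemma niceM f g : nice f -> nice g -> nice (f \* g).
Proof.
move=> [mf [M hM]] [mg [N hN]]; split; first exact: measurable_funM.
by exists (M * N) => y; rewrite normrM ler_pM.
Qed.

Lemma niceZ k f : nice f -> nice (k \*o f).
Proof. by move=> nf; exact: (niceM (nice_cst k) nf). Qed.

Lemma nice_integrable (s a : R) g : 0 <= s -> nice g ->
  (mp_law X a).-integrable setT (fun w => (g (mp_path X s w))%:E).
Proof.
move=> s0 [mg [M hM]].
apply: measurable_bounded_integrable => //=.
- by rewrite probability_setT ltry.
- by apply: measurableT_comp => //; exact: mp_measurable.
- exists M; split; first exact: num_real.
  move=> x Mx; rewrite /globally/= => w _.
  by apply: (le_trans (hM _)); exact: ltW.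
Qed.

Lemma expect_semigroup (s a : R) g : 0 <= s -> nice g ->
  mp_expect X a s g = (T s g a)%:E.
Proof.
move=> s0 ng; rewrite /T fineK// /mp_expect unlock.
exact/integrable_fin_num/(nice_integrable a s0 ng).
Qed.

Lemma semigroupE (s a : R) g : 0 <= s -> nice g ->
  (T s g a)%:E = (\int[mp_law X a]_w (g (mp_path X s w))%:E)%E.
Proof. by move=> s0 ng; rewrite -expect_semigroup// /mp_expect unlock. Qed.

Lemma semigroupD (s a : R) f g : 0 <= s -> nice f -> nice g ->
  T s (f \+ g) a = T s f a + T s g a.
Proof.
move=> s0 nf ng; apply: EFin_inj; rewrite EFinD !semigroupE//; last exact: niceD.
rewrite -integralD_EFin//; exact: nice_integrable.
Qed.

Lemma semigroupZ (s a k : R) f : 0 <= s -> nice f ->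
  T s (k \*o f) a = k * T s f a.
Proof.
move=> s0 nf; apply: EFin_inj; rewrite EFinM !semigroupE//; last exact: niceZ.
rewrite -integralZl//; exact: nice_integrable.
Qed.

Lemma semigroup_cst (s a k : R) : 0 <= s -> T s (cst k) a = k.
Proof.
move=> s0; apply: EFin_inj; rewrite semigroupE//; last exact: nice_cst.
rewrite -[RHS]mule1 -(probability_setT (mp_law X a)).
exact: (integral_cst (mp_law X a) measurableT k%:E).
Qed.

Lemma semigroup_le (s a : R) f g : 0 <= s -> nice f -> nice g ->
  (forall y, S y -> f y <= g y) -> T s f a <= T s g a.
Proof.
move=> s0 nf ng fg; rewrite -lee_fin !semigroupE//.
by apply: le_integral_any => w; rewrite lee_fin fg//; exact: mp_state.
Qed.

Lemma semigroup_norm_le (s a : R) f u : 0 <= s -> nice f -> nice u ->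
  (forall y, S y -> `|f y| <= u y) -> `|T s f a| <= T s u a.
Proof.
move=> s0 nf nu fu; rewrite ler_norml; apply/andP; split.
  rewrite lerNl -mulN1r -semigroupZ//; apply: semigroup_le => //.
    exact: niceZ.
  by move=> y Sy; have := fu _ Sy; rewrite ler_norml /= mulN1r lerNl => /andP[].
by apply: semigroup_le => // y Sy; have := fu _ Sy; rewrite ler_norml => /andP[].
Qed.

Lemma semigroup0 (a : R) g : S a -> nice g -> T 0 g a = g a.
Proof.
move=> Sa ng; apply: EFin_inj; rewrite semigroupE//.
have mX0 := @mp_measurable _ _ X 0 (lexx 0).
have mA : measurable [set w | mp_path X 0 w = a].
  by rewrite (_ : [set _ | _] = setT `&` mp_path X 0 @^-1` [set a]);
    [exact: mX0|rewrite setTI].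
transitivity (\int[mp_law X a]_w cst (g a)%:E w)%E.
  apply: ae_eq_integral => //.
  - exact: (measurable_int _ (nice_integrable a (lexx 0) ng)).
  - exists (~` [set w | mp_path X 0 w = a]); split; first exact: measurableC.
      by have := probability_setC (mp_law X a) mA; rewrite mp_start// subee.
    by move=> w /= h hw; apply: h => _; rewrite hw.
rewrite -[RHS]mule1 -(probability_setT (mp_law X a)).
exact: (integral_cst (mp_law X a) measurableT (g a)%:E).
Qed.

(** The semigroup property in the form of a comparison: the inner expectation,
as a function of its starting point, only has to be bounded by a measurable
function [u]. *)
Lemma semigroup_chain (s h : R) (a : R) g u : 0 <= s -> 0 <= h -> S a ->
  nice g -> nice u -> (forall b, S b -> T h g b <= u b) ->
  T (s + h) g a <= T s u a.
Proof.
move=> s0 h0 Sa ng nu gu.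
rewrite -lee_fin !semigroupE ?addr_ge0//.
have [mg bg] := ng.
have -> := @mp_markov _ _ X a s h setT g Sa s0 h0 _ mg bg; last first.
  by have -> : setT = ~` (set0 : set (mp_space X));
    [rewrite setC0|rewrite -setTD; apply: sigma_algebraCD; exact: sigma_algebra0].
apply: le_integral_any => w; rewrite -/(mp_expect X _ h g) expect_semigroup//.
by rewrite lee_fin gu//; exact: mp_state.
Qed.

Lemma semigroup_chain_norm (s h : R) (a : R) g g' u : 0 <= s -> 0 <= h -> S a ->
  nice g -> nice g' -> nice u -> (forall b, S b -> `|T h g b - g' b| <= u b) ->
  `|T (s + h) g a - T s g' a| <= T s u a.
Proof.
move=> s0 h0 Sa ng ng' nu gu.
have sh0 : 0 <= s + h by exact: addr_ge0.
rewrite ler_norml; apply/andP; split; last first.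
  rewrite lerBlDr -semigroupD//; apply: semigroup_chain => //; first exact: niceD.
  by move=> b Sb; have := gu _ Sb; rewrite ler_norml /= lerBlDr => /andP[].
have : T (s + h) (-1 \*o g) a <= T s (u \+ (-1 \*o g')) a.
  apply: semigroup_chain => //; first exact: niceZ.
    by apply: niceD => //; exact: niceZ.
  move=> b Sb; rewrite semigroupZ//=; have := gu _ Sb.
  by rewrite ler_norml => /andP[+ _]; lra.
rewrite semigroupD//; last exact: niceZ.
rewrite !semigroupZ//; lra.
Qed.

End markov_semigroup.

Lemma near_right0 (R : realType) (Q : R -> Prop) :
  (\forall h \near 0^'+, Q h) -> exists2 e : R, 0 < e & forall h, 0 < h -> h < e -> Q h.
Proof.
move=> [e /= e0 he]; exists e => // h h0 hlt.
by apply: he => //=; rewrite sub0r normrN gtr0_norm.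
Qed.

Section mean_value.
Context {R : realType} {S : set R} (X : markov_process S).
Local Notation T := (semigroup X).

(** A mean value inequality: a bound on the right derivative at time [0],
uniform over starting points, is transported to all times by cutting [0, H]
into short steps and using the semigroup property at each of them. The
oscillation [N] of [q] along the semigroup measures how far
[T_s q] may drift from [q] before time [H]. *)
Lemma semigroup_increment (g q : R -> R) (M N H : R) :
  nice g -> nice q -> 0 <= H ->
  (forall e : R, 0 < e -> \forall h \near 0^'+, forall a, S a ->
     `|T h g a - g a - h * q a| <= h * (M + e)) ->
  (forall s a, 0 <= s -> s <= H -> S a -> `|T s q a - q a| <= N) ->
  forall a, S a -> `|T H g a - g a - H * q a| <= H * (M + N).
Proof.
move=> ng nq H0 gen qN a Sa.
have [->|Hn0] := eqVneq H 0.
  by rewrite semigroup0// !mul0r subr0 subrr normr0.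
have {}H0 : 0 < H by rewrite lt_neqAle eq_sym Hn0.
apply/ler_addgt0Pr => e e0.
have eH0 : 0 < e / H by rewrite divr_gt0.
have [d d0 hd] := near_right0 (gen _ eH0).
(* Enough steps for each of them to be shorter than [d]. *)
pose m := (Num.truncn (H / d)).+1.
have m0 : 0 < m%:R :> R by rewrite ltr0n.
pose h := H / m%:R.
have h0 : 0 < h by rewrite divr_gt0.
have hlt : h < d.
  by rewrite /h ltr_pdivrMr// mulrC -ltr_pdivrMr// truncnS_gt.
have mh : m%:R * h = H by rewrite /h mulrC divfK// gt_eqF.
have {}hd := hd h h0 hlt.
suff main i : (i <= m)%N ->
    `|T (i%:R * h) g a - g a - i%:R * h * q a| <= i%:R * h * (M + N + e / H).
  have := main m (leqnn _); rewrite mh => /le_trans; apply.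
  by rewrite mulrDr lerD2l mulrC divfK// gt_eqF.
elim: i => [_|i ih im].
  by rewrite !mul0r semigroup0// subr0 subrr normr0.
have ih0 : 0 <= i%:R * h by rewrite mulr_ge0// ltW.
have {}ih := ih (ltnW im).
have ngq : nice (g \+ (h \*o q)) by apply: niceD => //; exact: niceZ.
have := @semigroup_chain_norm _ _ X (i%:R * h) h a g (g \+ (h \*o q))
  (cst (h * (M + e / H))) ih0 (ltW h0) Sa ng ngq (nice_cst _).
rewrite semigroup_cst// semigroupD ?semigroupZ//; last exact: niceZ.
have -> : i%:R * h + h = i.+1%:R * h by rewrite -[in RHS]addn1 natrD; ring.
have hb : forall b, S b -> `|T h g b - (g \+ h \*o q) b| <= cst (h * (M + e / H)) b.
  by move=> b Sb /=; have := hd b Sb; rewrite opprD addrA.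
move=> /(_ hb) step.
have iH : i%:R * h <= H.
  by rewrite -mh ler_wpM2r ?(ltW h0)// ler_nat ltnW.
have qb : `|h * (T (i%:R * h) q a - q a)| <= h * N.
  by rewrite normrM gtr0_norm// ler_wpM2l ?(ltW h0)// qN.
set A := T (i.+1%:R * h) g a in step *.
set B := T (i%:R * h) g a in step ih.
set Q := T (i%:R * h) q a in step qb.
have -> : A - g a - i.+1%:R * h * q a =
   (A - (B + h * Q)) + (B - g a - i%:R * h * q a) + h * (Q - q a).
  by rewrite -[in LHS]addn1 natrD; ring.
have -> : i.+1%:R * h * (M + N + e / H) =
   h * (M + e / H) + i%:R * h * (M + N + e / H) + h * N.
  by rewrite -[in LHS]addn1 natrD; ring.
by rewrite (le_trans (ler_normD _ _))// lerD// (le_trans (ler_normD _ _))// lerD.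
Qed.

Lemma generator_increment (D : set (R -> R)) (L : (R -> R) -> R -> R)
    (g q : R -> R) (M N H : R) : has_generator X D L -> D g ->
  nice g -> nice q -> 0 <= H ->
  (forall a, S a -> `|L g a - q a| <= M) ->
  (forall s a, 0 <= s -> s <= H -> S a -> `|T s q a - q a| <= N) ->
  forall a, S a -> `|T H g a - g a - H * q a| <= H * (M + N).
Proof.
move=> gen Dg ng nq H0 LM qN; apply: semigroup_increment => // e e0.
have := gen g Dg e e0; apply: filter_app; near=> h => hb a Sa.
have h0 : 0 < h by near: h; exact: nbhs_right_gt.
have := lerD (hb a Sa) (LM a Sa).
rewrite -/(semigroup X h g a) => /(le_trans (ler_normD _ _)).
rewrite -(ler_pM2l h0) -[X in X * `|_|](gtr0_norm h0) -normrM [e + M]addrC.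
congr (`|_| <= _); field; exact: lt0r_neq0.
Unshelve. all: by end_near. Qed.

Lemma semigroup_lipschitz (D : set (R -> R)) (L : (R -> R) -> R -> R)
    (g : R -> R) (M s : R) : has_generator X D L -> D g ->
  nice g -> 0 <= s -> (forall a, S a -> `|L g a| <= M) ->
  forall a, S a -> `|T s g a - g a| <= s * M.
Proof.
move=> gen Dg ng s0 LM a Sa.
have := generator_increment (q := cst 0) (N := 0) gen Dg ng (nice_cst 0) s0
  _ _ Sa (M := M).
rewrite /= mulr0 subr0 addr0; apply.
  by move=> b Sb; rewrite subr0; exact: LM.
by move=> u b u0 _ Sb; rewrite semigroup_cst// subrr normr0.
Qed.

End mean_value.

(** * Calculus on the line *)

Section calculus.
Context {R : realType}.
Implicit Types (f g : R -> R).

Definition is_deriv f g : Prop := forall x : R, is_derive x (1 : R) f (g x).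

Lemma is_deriv_continuous f g : is_deriv f g -> continuous f.
Proof.
by move=> fg x; apply/differentiable_continuous/derivable1_diffP; case: (fg x).
Qed.

Lemma is_deriv_comp f f' g g' : is_deriv f f' -> is_deriv g g' ->
  is_deriv (f \o g) (fun x => f' (g x) * g' x).
Proof. by move=> ff gg x; exact: (is_derive1_comp (ff (g x)) (gg x)). Qed.

Lemma is_deriv_affine (p q : R) : is_deriv (fun x => p * x + q) (cst p).
Proof.
move=> x; have h := is_deriveD (is_deriveZ p (is_derive_id x (1 : R)))
  (is_derive_cst q x (1 : R)).
by apply: (is_derive_eq h); rewrite addr0 /GRing.scale/= mulr1.
Qed.

Lemma is_deriv_shift f f' (c : R) : is_deriv f f' ->
  is_deriv (fun x => f (x + c)) (fun x => f' (x + c)).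
Proof.
move=> ff; have := is_deriv_comp ff (is_deriv_affine 1 c).
have -> : (f \o (fun x : R => 1 * x + c)) = (fun x => f (x + c)).
  by apply/funext => x /=; rewrite mul1r.
suff -> : (fun x : R => f' (1 * x + c) * cst 1 x) = (fun x => f' (x + c)) by [].
by apply/funext => x /=; rewrite mul1r mulr1.
Qed.

Lemma is_derivD f f' g g' : is_deriv f f' -> is_deriv g g' ->
  is_deriv (fun x => f x + g x) (fun x => f' x + g' x).
Proof. by move=> ff gg x; exact: (is_deriveD (ff x) (gg x)). Qed.

Lemma is_derivZ (k : R) f f' : is_deriv f f' ->
  is_deriv (fun x => k * f x) (fun x => k * f' x).
Proof. by move=> ff x; exact: (is_deriveZ k (ff x)). Qed.

Lemma is_derivM f f' g g' : is_deriv f f' -> is_deriv g g' ->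
  is_deriv (fun x => f x * g x) (fun x => f x * g' x + g x * f' x).
Proof. by move=> ff gg x; exact: (is_deriveM (ff x) (gg x)). Qed.

Lemma eq_is_deriv f f' g g' : is_deriv f f' -> f =1 g -> f' =1 g' ->
  is_deriv g g'.
Proof. by move=> ff /funext <- /funext <-. Qed.

Lemma mean_value_le f f' (a b M : R) : is_deriv f f' -> a <= b ->
  (forall x, a <= x -> x <= b -> `|f' x| <= M) -> `|f b - f a| <= M * (b - a).
Proof.
move=> ff ab fM.
have [|c cab ->] := MVT_segment ab (fun x _ => ff x).
  exact/continuous_subspaceT/is_deriv_continuous/ff.
rewrite normrM (ger0_norm (_ : 0 <= b - a)) ?subr_ge0//.
by rewrite ler_wpM2r ?subr_ge0// fM// (itvP cab).
Qed.

Lemma lipschitz_deriv f f' (M : R) : is_deriv f f' ->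
  (forall x, `|f' x| <= M) -> forall x y, `|f x - f y| <= M * `|x - y|.
Proof.
move=> ff fM x y; wlog xy : x y / y <= x => [hw|].
  case: (leP y x) => [/hw//|/ltW/hw]; by rewrite distrC [`|y - x|]distrC.
by rewrite (ger0_norm (_ : 0 <= x - y)) ?subr_ge0//; exact: mean_value_le ff _ _.
Qed.

(** Taylor's formula for the symmetric second difference, with an arbitrary
reference value [q]: [q = 0] gives the bound of the discrete Laplacian by the
second derivative, [q = g'' x] gives the consistency error. *)
Lemma second_difference g g1 g2 (x s q M : R) :
  is_deriv g g1 -> is_deriv g1 g2 -> 0 <= s ->
  (forall y, `|y - x| <= s -> `|g2 y - q| <= M) ->
  `|g (x + s) + g (x - s) - 2 * g x - s ^+ 2 * q| <= 2 * s ^+ 2 * M.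
Proof.
move=> gg1 gg2 s0 gM.
have sym f f' : is_deriv f f' -> is_deriv (fun u => f (- u + x)) (fun u => - f' (- u + x)).
  move=> ff; have := is_deriv_comp ff (is_deriv_affine (-1) x).
  by move/eq_is_deriv; apply => u /=; rewrite mulN1r// mulrN1.
pose G u := g (u + x) + g (- u + x) - u ^+ 2 * q.
pose G1 u := g1 (u + x) - g1 (- u + x) - 2 * q * u.
pose G2 u := g2 (u + x) + g2 (- u + x) - 2 * q.
have lin : is_deriv (fun u : R => u) (cst 1) by move=> u; exact: is_derive_id.
have dG : is_deriv G G1.
  apply: (eq_is_deriv (is_derivD (is_derivD (is_deriv_shift x gg1) (sym _ _ gg1))
    (is_derivZ (- q) (is_derivM lin lin)))) => u /=; rewrite /G /G1 ?expr2; ring.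
have dG1 : is_deriv G1 G2.
  apply: (eq_is_deriv (is_derivD (is_derivD (is_deriv_shift x gg2)
    (is_derivZ (-1) (sym _ _ gg2)))
    (is_derivZ (- (2 * q)) lin))) => u /=; rewrite /G2 /G1; ring.
have M0 : 0 <= M by apply: le_trans (gM x _); rewrite // subrr normr0.
have G1b u : 0 <= u -> u <= s -> `|G1 u| <= 2 * M * s.
  move=> u0 us.
  have -> : G1 u = G1 u - G1 0 by rewrite /G1 oppr0 add0r; ring.
  have : `|G1 u - G1 0| <= 2 * M * (u - 0).
    apply: (mean_value_le dG1) => // w w0 wu; rewrite /G2.
    have -> : g2 (w + x) + g2 (- w + x) - 2 * q =
      (g2 (w + x) - q) + (g2 (- w + x) - q) by ring.
    rewrite (le_trans (ler_normD _ _))// mulrDl mul1r lerD// gM//.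
      by rewrite addrK ger0_norm// (le_trans wu).
    by rewrite addrK normrN ger0_norm// (le_trans wu).
  by rewrite subr0 => /le_trans; apply; rewrite ler_wpM2l// mulr_ge0.
have := mean_value_le dG s0 G1b.
rewrite subr0 /G oppr0 add0r expr0n/= mul0r subr0 [s + x]addrC [- s + x]addrC.
by rewrite (_ : 2 * M * s * s = 2 * s ^+ 2 * M); [congr (`|_| <= _)|]; ring.
Qed.

End calculus.

Section pos_power.
Context {R : realType}.
Local Notation pos := (fun u : R => Num.max u 0).

Lemma pos_continuous : continuous pos.
Proof. by move=> x; apply: (@continuous_max _ _ idfun (cst 0) x) => //; exact: cvg_cst. Qed.

Lemma is_deriv_pos_power k :
  is_deriv (fun u : R => Num.max u 0 ^+ k.+2) (fun u => k.+2%:R * Num.max u 0 ^+ k.+1).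
Proof.
move=> x; have [x0|x0|->] := ltgtP x 0.
- have h : \forall y \near x, cst 0 y = Num.max y 0 ^+ k.+2.
    near=> y; have y0 : y < 0 by near: y; exact: lt_nbhsl.
    by rewrite max_r ?expr0n//; exact: ltW.
  rewrite /= expr0n mulr0.
  exact: (near_eq_is_derive h).
- have h : \forall y \near x, y ^+ k.+2 = Num.max y 0 ^+ k.+2.
    near=> y; have y0 : 0 < y by near: y; exact: lt_nbhsr.
    by rewrite max_l//; exact: ltW.
  apply: (near_eq_is_derive h).
  apply: DeriveDef; first exact: exprn_derivable.
  rewrite exp_derive [LHS]mulr1; congr (_ * _ ^+ _).
(* At the origin, Caratheodory's slope function is itself a power. *)
- apply/is_derive1_caratheodory; exists (fun u => Num.max u 0 ^+ k.+1); split.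
  + move=> z; rewrite subr0 maxxx expr0n subr0 exprSr.
    case: (leP z 0) => [z0|z0]//; by rewrite !expr0n/= mulr0 mul0r.
  + apply: (@continuous_comp _ _ _ pos (fun y : R => y ^+ k.+1) 0).
      exact: pos_continuous.
    exact: exprn_continuous.
  + by rewrite maxxx expr0n/= mulr0.
Unshelve. all: by end_near. Qed.

End pos_power.

Section twice_derivable.
Context {R : realType}.
Implicit Types (f g : R -> R).

Definition twice_derivable f f2 : Prop :=
  [/\ exists2 f1, is_deriv f f1 & is_deriv f1 f2 & continuous f2].

Lemma C2_twice_derivable f f2 : twice_derivable f f2 ->
  C2 f /\ derive1n 2 f = f2.
Proof.
move=> [[f1 ff1 ff2] cf2].
have d1 : derive1 f = f1.
  by apply/funext => x; rewrite derive1E; have [_ ->] := ff1 x.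
have d2 : derive1n 2 f = f2.
  apply/funext => x; rewrite -[derive1n 2 f]/(derive1 (derive1 f)) d1 derive1E.
  by have [_ ->] := ff2 x.
split => //; split; last by rewrite d2.
- by move=> x; case: (ff1 x).
- by move=> x; rewrite d1; case: (ff2 x).
Qed.

Lemma twice_derivable_continuous f f2 : twice_derivable f f2 -> continuous f.
Proof. by move=> [[f1 ff1 _] _]; exact: is_deriv_continuous ff1. Qed.

Lemma twice_derivable_shift f f2 (c : R) : twice_derivable f f2 ->
  twice_derivable (fun x => f (x + c)) (fun x => f2 (x + c)).
Proof.
move=> [[f1 ff1 ff2] cf2]; split.
  by exists (fun x => f1 (x + c)); exact: is_deriv_shift.
move=> x; apply: (@continuous_comp _ _ _ (fun y : R => y + c) f2).
  by apply: cvgD; [exact: cvg_id|exact: cvg_cst].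
exact: cf2.
Qed.

Lemma twice_derivable_lin f f2 g g2 (p q : R) : twice_derivable f f2 ->
  twice_derivable g g2 ->
  twice_derivable (fun x => p * f x + q * g x) (fun x => p * f2 x + q * g2 x).
Proof.
move=> [[f1 ff1 ff2] cf2] [[g1 gg1 gg2] cg2]; split.
  exists (fun x => p * f1 x + q * g1 x).
    exact: is_derivD (is_derivZ p ff1) (is_derivZ q gg1).
  exact: is_derivD (is_derivZ p ff2) (is_derivZ q gg2).
move=> x; apply: cvgD.
  by apply: cvgM; [exact: cvg_cst|exact: cf2].
by apply: cvgM; [exact: cvg_cst|exact: cg2].
Qed.

End twice_derivable.

Section cutoff.
Context {R : realType}.

Let pos (u : R) : R := Num.max u 0.

(** An explicit compactly supported function, C^2 because [max u 0 ^ 3] is. It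
is not constant near [0]; the quadratic bound of [1 - bump] plays
the role of a plateau. *)
Definition bump (x : R) : R := Num.max (1 - x ^+ 2) 0 ^+ 3.

Let u_ (x : R) : R := 1 - x ^+ 2.
Let bump1 (x : R) : R := - 6 * x * pos (u_ x) ^+ 2.
Let bump2 (x : R) : R := - 6 * pos (u_ x) ^+ 2 + 24 * x ^+ 2 * pos (u_ x).

Let du : is_deriv u_ (fun x => - 2 * x).
Proof.
have lin : is_deriv (fun u : R => u) (cst 1) by move=> u; exact: is_derive_id.
apply: (eq_is_deriv (is_derivD (is_deriv_affine 0 1) (is_derivZ (-1) (is_derivM lin lin))))
  => x /=; rewrite /u_; ring.
Qed.

Let dbump : is_deriv bump bump1.
Proof.
apply: (eq_is_deriv (is_deriv_comp (is_deriv_pos_power 1) du)) => x //=.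
rewrite /bump1 /pos; ring.
Qed.

Let dbump1 : is_deriv bump1 bump2.
Proof.
have lin := is_deriv_affine (-6 : R) 0.
apply: (eq_is_deriv (is_derivM lin (is_deriv_comp (is_deriv_pos_power 0) du))) => x /=;
  rewrite /bump1 /bump2 /pos; ring.
Qed.

Let pos_u x : 0 <= pos (u_ x) <= 1.
Proof.
rewrite /pos le_max lexx orbT ge_max ler01 andbT /u_ lerBlDr lerDl.
exact: sqr_ge0.
Qed.

Lemma bump_ge0 x : 0 <= bump x.
Proof. by rewrite exprn_ge0// le_max lexx orbT. Qed.

Lemma bump_le1 x : bump x <= 1.
Proof. by apply: exprn_ile1; case/andP: (pos_u x). Qed.

Lemma bump_out x : 1 <= `|x| -> bump x = 0.
Proof.
move=> x1; rewrite /bump max_r ?expr0n//.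
by rewrite subr_le0 -real_normK ?num_real// expr_ge1.
Qed.

Lemma bump_near1 x : 1 - bump x <= 3 * x ^+ 2.
Proof.
rewrite /bump -/(u_ x) -/(pos _).
have : 1 - x ^+ 2 <= pos (u_ x) by rewrite le_max lexx.
have /andP[] := pos_u x; set p := pos _ => p0 p1 hp.
have : 1 - p ^+ 3 <= 3 * (1 - p).
  have -> : 1 - p ^+ 3 = (1 - p) * (1 + p + p ^+ 2) by ring.
  rewrite mulrC ler_wpM2r ?subr_ge0//.
  have : p ^+ 2 <= 1 by apply: exprn_ile1.
  lra.
lra.
Qed.

Let sq_pos x : x ^+ 2 * pos (u_ x) <= 1.
Proof.
rewrite /pos; case: (leP (u_ x) 0) => [|h]; first by rewrite mulr0.
have := sqr_ge0 x; move: h; rewrite /u_; set y := x ^+ 2 => h y0.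
by rewrite mulr_ile1//; lra.
Qed.

Let bump1_le x : `|bump1 x| <= 6.
Proof.
rewrite /bump1 -mulrA normrM normrN [`|6|]ger0_norm// -[leRHS]mulr1 ler_wpM2l//.
have /andP[] := pos_u x; have := sq_pos x; set p := pos _ => h p0 p1.
rewrite -(@expr_le1 _ 2)// real_normK ?num_real//.
have -> : (x * p ^+ 2) ^+ 2 = (x ^+ 2 * p) * p ^+ 3 by ring.
by rewrite mulr_ile1 ?exprn_ile1 ?exprn_ge0// mulr_ge0 ?sqr_ge0.
Qed.

Let bump2_le x : `|bump2 x| <= 30.
Proof.
have /andP[] := pos_u x; have := sq_pos x; rewrite /bump2.
set p := pos _ => h p0 p1.
have h2 : 0 <= x ^+ 2 * p by rewrite mulr_ge0 ?sqr_ge0.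
have : p ^+ 2 <= 1 by apply: exprn_ile1.
have := sqr_ge0 p.
rewrite ler_norml -mulrA; set y := x ^+ 2 * p in h h2 *; set z := p ^+ 2.
by move=> *; apply/andP; split; lra.
Qed.

Definition cutoff (r x : R) : R := bump (r^-1 * x).

Lemma cutoff_ge0 r x : 0 <= cutoff r x. Proof. exact: bump_ge0. Qed.

Lemma cutoff_le1 r x : cutoff r x <= 1. Proof. exact: bump_le1. Qed.

Lemma cutoff_out r x : 0 < r -> r <= `|x| -> cutoff r x = 0.
Proof.
move=> r0 rx; apply: bump_out.
by rewrite normrM gtr0_norm ?invr_gt0// mulrC ler_pdivlMr ?mul1r.
Qed.

Lemma cutoff_near1 r x : 1 - cutoff r x <= 3 * x ^+ 2 / r ^+ 2.
Proof.
apply: (le_trans (bump_near1 _)).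
by rewrite exprMn exprVn mulrA mulrAC.
Qed.

Lemma cutoff_twice_derivable r : exists c1 c2 : R -> R,
  [/\ is_deriv (cutoff r) c1, is_deriv c1 c2, continuous c2,
    forall x, `|c1 x| <= 6 / `|r| & forall x, `|c2 x| <= 30 / r ^+ 2].
Proof.
have aff := is_deriv_affine r^-1 0.
exists (fun x => bump1 (r^-1 * x) * r^-1), (fun x => bump2 (r^-1 * x) * r^-1 * r^-1).
split.
- apply: (eq_is_deriv (is_deriv_comp dbump aff)) => x /=; first by rewrite addr0.
  by rewrite addr0.
- apply: (eq_is_deriv (is_derivZ r^-1 (is_deriv_comp dbump1 aff))) => x /=;
  rewrite addr0; ring.
- move=> x; apply: cvgM; last exact: cvg_cst.
  apply: cvgM; last exact: cvg_cst.
  have clin : {for x, continuous (fun y : R => r^-1 * y)}.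
    by apply: cvgM; [exact: cvg_cst|exact: cvg_id].
  apply: (@continuous_comp _ _ _ (fun y : R => r^-1 * y) bump2); first exact: clin.
  set z := r^-1 * x.
  have cpos : {for z, continuous (fun x => pos (u_ x))}.
    apply: (@continuous_comp _ _ _ u_ pos); last exact: pos_continuous.
    exact: (is_deriv_continuous du).
  apply: cvgD; first by apply: cvgM; [exact: cvg_cst|apply: cvgM].
  apply: cvgM => //; apply: cvgM; first exact: cvg_cst.
  exact: exprn_continuous.
- move=> x; rewrite normrM normfV ler_wpM2r ?invr_ge0//.
- move=> x; rewrite !normrM -mulrA ler_pM ?mulr_ge0//.
  by rewrite -normrM -expr2 exprVn ger0_norm ?invr_ge0 ?sqr_ge0.
Qed.

End cutoff.

(** * Mollification, test functions and the walk operator *)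

Section mollification.
Context {R : realType}.
Implicit Types (f g u a : R -> R).

Definition supported (B : R) f : Prop := forall x, B <= `|x| -> f x = 0.

Definition holder (L kappa : R) f : Prop :=
  forall x y, `|f x - f y| <= L * `|x - y| `^ kappa.

Lemma holder_continuous (L kappa : R) f : 0 <= L -> 0 < kappa ->
  holder L kappa f -> continuous f.
Proof.
move=> L0 k0 hf x.
apply/cvgrPdist_le => e e0.
pose d := (e / (L + 1)) `^ kappa^-1.
have L1 : 0 < L + 1 by rewrite ltr_wpDl.
have d0 : 0 < d by rewrite powR_gt0// divr_gt0.
near=> y; apply: (le_trans (hf x y)).
have yd : `|x - y| <= d by near: y; exists d => //= z /ltW.
have : `|x - y| `^ kappa <= d `^ kappa.
  by apply: ge0_ler_powR; rewrite ?nnegrE//; exact: ltW.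
rewrite /d -powRrM mulVf ?gt_eqF// powRr1; last by rewrite ltW// divr_gt0.
move=> h.
apply: (le_trans (ler_wpM2l L0 h)).
rewrite mulrCA ger_pMr// ler_pdivrMr// mul1r lerDl; exact: ler01.
Unshelve. all: by end_near. Qed.

(** The primitive is started to the left of the support, where it vanishes
identically, so that the fundamental theorem is only used inside an
interval. *)
Lemma antiderivative B f : continuous f -> supported B f ->
  exists F, is_deriv F f.
Proof.
move=> cf sf.
pose a := - B - 1.
pose F (x : R) : R := (\int[lebesgue_measure]_(t in [set` `[a, x]]) (f t))%R.
exists F => x; have [ax|xa] := ltP a x.
  have int : lebesgue_measure.-integrable [set` `[a, x + 1]] (EFin \o f).
    apply: continuous_compact_integrable; first exact: segment_compact.
    exact: continuous_subspaceT.
  have x1 : x < x + 1 by rewrite ltrDl.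
  have [dF F'] := continuous_FTC1_closed x1 int ax (cf x).
  by apply: DeriveDef => //; rewrite -F' derive1E.
have xB : x < - B by move: xa; rewrite /a; lra.
have F0 y : y < - B -> F y = 0.
  move=> yB; rewrite /F /Rintegral (_ : (\int[_]_(x in _) _)%E = 0%E)//.
  apply: integral0_eq => z /=; rewrite in_itv/= => /andP[_ zy].
  by rewrite sf// -normrN (le_trans _ (ler_norm _))//; lra.
rewrite sf; last by rewrite -normrN (le_trans _ (ler_norm _))// lerNr ltW.
have h : \forall y \near x, cst 0 y = F y.
  by near=> y; rewrite F0//; near: y; exact: lt_nbhsl.
exact: (near_eq_is_derive h).
Unshelve. all: by end_near. Qed.


Lemma supported_shift B d f : 0 <= d -> supported B f ->
  supported (B + d) (fun x => f (x + d)).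
Proof.
move=> d0 sf x xB; apply: sf; rewrite -lerBDr in xB.
apply: (le_trans xB); rewrite lerBlDr -{2}(ger0_norm d0).
by rewrite -[leLHS]/(`|x|) -{1}(addrK d x); exact: ler_normB.
Qed.

Lemma supportedS B B' f : B <= B' -> supported B f -> supported B' f.
Proof. by move=> BB' sf x xB; apply: sf; exact: le_trans xB. Qed.

Lemma supported_bounded_support B f : supported B f -> bounded_support f.
Proof. by move=> sf; exists B => x /ltW; exact: sf. Qed.

Definition dquot (d : R) f x : R := (f (x + d) - f x) / d.

Lemma dquot_is_deriv d f g : is_deriv f g -> is_deriv (dquot d f) (dquot d g).
Proof.
move=> fg.
apply: (eq_is_deriv (is_derivZ d^-1 (is_derivD (is_deriv_shift d fg) (is_derivZ (-1) fg))));
  by move=> x; rewrite /dquot mulN1r mulrC.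
Qed.

Lemma dquot_supported d B f : 0 <= d -> supported B f ->
  supported (B + d) (dquot d f).
Proof.
move=> d0 sf x xB; rewrite /dquot (supported_shift d0 sf xB) sf ?subr0 ?mul0r//.
by apply: le_trans xB; rewrite lerDl.
Qed.

Lemma dquot_le d M f : 0 < d -> (forall x, `|f x| <= M) ->
  forall x, `|dquot d f x| <= 2 * M / d.
Proof.
move=> d0 fM x; rewrite /dquot normrM normfV (gtr0_norm d0).
rewrite ler_pM2r ?invr_gt0// (le_trans (ler_normB _ _))// mulr_natl mulr2n.
by rewrite lerD.
Qed.

Lemma dquot_holder d L kappa f : 0 < d -> holder L kappa f ->
  forall x, `|dquot d f x| <= L * d `^ kappa / d.
Proof.
move=> d0 hf x; rewrite /dquot normrM normfV (gtr0_norm d0).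
rewrite ler_pM2r ?invr_gt0// (le_trans (hf _ _))// [x + d]addrC addrK.
by rewrite gtr0_norm.
Qed.

(** The moving average [x |-> (1/d) int_x^(x+d) u], written as the difference
quotient of a primitive [U]. Its derivative is the difference quotient of [u],
which gains a factor [d ^ (kappa - 1)] from the regularity of [u], and the mean
value theorem transfers bounds on [u] to it. *)
Lemma averaging L kappa B d u : 0 <= L -> 0 < kappa -> 0 < d ->
  holder L kappa u -> supported B u ->
  exists a, [/\ is_deriv a (dquot d u), holder L kappa a, supported (B + d) a &
    forall x, `|a x - u x| <= L * d `^ kappa].
Proof.
move=> L0 k0 d0 hu su.
have [U dU] := antiderivative (holder_continuous L0 k0 hu) su.
have mv x q M : (forall s, 0 <= s -> s <= d -> `|u (x + s) - q| <= M) ->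
    `|dquot d U x - q| <= M.
  move=> h.
  have dV : is_deriv (fun s => U (s + x) - q * s) (fun s => u (s + x) - q).
    apply: (eq_is_deriv (is_derivD (is_deriv_shift x dU) (is_deriv_affine (-q) 0)));
    by move=> s /=; rewrite ?addr0 ?mulNr.
  have := mean_value_le dV (ltW d0) (M := M).
  rewrite !subr0 add0r mulr0 subr0 => /(_ _).
  have -> : dquot d U x - q = (U (d + x) - q * d - U x) / d.
    by rewrite /dquot [d + x]addrC; field; exact: lt0r_neq0.
  move=> h'; rewrite normrM normfV (gtr0_norm d0) ler_pdivrMr//.
  by apply: h' => s s0 sd; rewrite [s + x]addrC; exact: h.
exists (dquot d U); split.
- exact: dquot_is_deriv.
- move=> x y.
  have dV : is_deriv (fun s => U (s + x) - U (s + y)) (fun s => u (s + x) - u (s + y)).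
    apply: (eq_is_deriv (is_derivD (is_deriv_shift x dU)
      (is_derivZ (-1) (is_deriv_shift y dU)))) => s; by rewrite mulN1r.
  have := mean_value_le dV (ltW d0) (M := L * `|x - y| `^ kappa).
  rewrite !add0r subr0 => h.
  have -> : dquot d U x - dquot d U y = (U (d + x) - U (d + y) - (U x - U y)) / d.
    by rewrite /dquot [d + x]addrC [d + y]addrC; field; exact: lt0r_neq0.
  rewrite normrM normfV (gtr0_norm d0) ler_pdivrMr//; apply: h => s _ _.
  by rewrite (le_trans (hu _ _))// (_ : s + x - (s + y) = x - y)//; ring.
- move=> x xB; apply/eqP; rewrite -normr_le0 -[dquot d U x]subr0.
  apply: mv => s s0 sd; rewrite subr0 su ?normr0//.
  rewrite -lerBDr in xB; apply: (le_trans xB).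
  rewrite lerBlDr (@le_trans _ _ (`|x + s| + s))// ?lerD2l//.
  by rewrite -{1}(addrK s x) (le_trans (ler_normB _ _))// (ger0_norm s0).
- move=> x; apply: mv => s s0 sd; rewrite (le_trans (hu _ _))//.
  rewrite ler_wpM2l// [x + s]addrC addrK ger0_norm//.
  by apply: ge0_ler_powR; rewrite ?nnegrE//; exact: ltW.
Qed.

(** Only the even derivatives are named: [v2] and [v4] stand for the second and
fourth derivatives, and the third one is felt through the Lipschitz constant
of [v2]. The class is stable under averaging of translates, with the same
constants apart from the support. *)
Record test_function (L kappa M2 M3 M4 B : R) (v v2 v4 : R -> R) : Prop := {
  test_twice : twice_derivable v v2 ;
  test_fourth : twice_derivable v2 v4 ;
  test_holder : holder L kappa v ;
  test_bound2 : forall x, `|v2 x| <= M2 ;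
  test_lipschitz2 : forall x y, `|v2 x - v2 y| <= M3 * `|x - y| ;
  test_bound4 : forall x, `|v4 x| <= M4 ;
  test_supported : supported B v ;
  test_supported2 : supported B v2
}.

(** Four moving averages. Every derivative of the result turns one average into
a difference quotient, so that the [j]-th derivative is an iterated difference
quotient of a [kappa]-regular function, of order [d ^ (kappa - j)]. *)
Lemma mollification L kappa B d f : 0 <= L -> 0 < kappa -> 0 < d ->
  holder L kappa f -> supported B f ->
  exists v v2 v4,
    test_function L kappa (2 * L * d `^ kappa / d ^+ 2)
      (4 * L * d `^ kappa / d ^+ 3) (8 * L * d `^ kappa / d ^+ 4) (B + 4 * d)
      v v2 v4 /\
    forall x, `|v x - f x| <= 4 * L * d `^ kappa.
Proof.
move=> L0 k0 d0 hf sf.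
have [a1 [da1 ha1 sa1 e1]] := averaging L0 k0 d0 hf sf.
have [a2 [da2 ha2 sa2 e2]] := averaging L0 k0 d0 ha1 sa1.
have [a3 [da3 ha3 sa3 e3]] := averaging L0 k0 d0 ha2 sa2.
have [a4 [da4 ha4 sa4 e4]] := averaging L0 k0 d0 ha3 sa3.
have cdq u : continuous u -> continuous (dquot d u).
  move=> cu x; apply: cvgM; last exact: cvg_cst.
  apply: cvgB; last exact: cu.
  apply: (@continuous_comp _ _ _ (fun y : R => y + d) u); last exact: cu.
  by apply: cvgD; [exact: cvg_id|exact: cvg_cst].
have dn0 : d != 0 by exact: lt0r_neq0.
exists a4, (dquot d (dquot d a2)), (dquot d (dquot d (dquot d (dquot d f)))); split; [split|].
- split; first by exists (dquot d a3) => //; exact: dquot_is_deriv.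
  by do 2 apply: (cdq); exact: is_deriv_continuous da2.
- split; last by do 4 apply: (cdq); exact: holder_continuous hf.
  exists (dquot d (dquot d (dquot d a1))); first by do 2 apply: dquot_is_deriv.
  by do 3 apply: dquot_is_deriv.
- exact: ha4.
- move=> x; have := dquot_le d0 (dquot_holder d0 ha2) x.
  by move/le_trans; apply; rewrite le_eqVlt; apply/orP; left; apply/eqP; field.
- apply: (lipschitz_deriv (f' := dquot d (dquot d (dquot d a1)))).
    by do 2 apply: dquot_is_deriv.
  move=> x; have := dquot_le d0 (dquot_le d0 (dquot_holder d0 ha1)) x.
  by move/le_trans; apply; rewrite le_eqVlt; apply/orP; left; apply/eqP; field.
- move=> x; have := dquot_le d0 (dquot_le d0 (dquot_le d0 (dquot_holder d0 hf))) x.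
  by move/le_trans; apply; rewrite le_eqVlt; apply/orP; left; apply/eqP; field.
- by apply: supportedS sa4; lra.
- have := dquot_supported (ltW d0) (dquot_supported (ltW d0) sa2).
  by apply: supportedS; lra.
- move=> x.
  have -> : a4 x - f x = (a4 x - a3 x) + (a3 x - a2 x) + (a2 x - a1 x) + (a1 x - f x).
    by ring.
  have -> : 4 * L * d `^ kappa = L * d `^ kappa + L * d `^ kappa +
    L * d `^ kappa + L * d `^ kappa by ring.
  do 3 (rewrite (le_trans (ler_normD _ _))// lerD//).
Qed.

(** One step of the symmetric walk with steps of length [r]. Its powers replace
the heat semigroup: they commute with derivatives and contract the supremum
norm, so the bounds on a test function persist along the evolution. *)
Definition walk_step (r : R) f x : R := (f (x + r) + f (x - r)) / 2.

Lemma walk_step_test L kappa M2 M3 M4 B r v v2 v4 : 0 <= r ->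
  test_function L kappa M2 M3 M4 B v v2 v4 ->
  test_function L kappa M2 M3 M4 (B + r) (walk_step r v) (walk_step r v2)
    (walk_step r v4).
Proof.
move=> r0 [tv tv2 hv b2 l2 b4 s s2].
have wtd g g2 : twice_derivable g g2 ->
    twice_derivable (walk_step r g) (walk_step r g2).
  move=> tg.
  have := twice_derivable_lin 2^-1 2^-1 (twice_derivable_shift r tg)
    (twice_derivable_shift (- r) tg).
  rewrite -[X in twice_derivable X]/(fun x => 2^-1 * g (x + r) + 2^-1 * g (x - r)).
  suff E u : walk_step r u = (fun x => 2^-1 * u (x + r) + 2^-1 * u (x - r)).
    by rewrite !E.
  by apply/funext => x; rewrite /walk_step mulrDl ![_ / 2]mulrC.
have wb g M : (forall x, `|g x| <= M) -> forall x, `|walk_step r g x| <= M.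
  move=> gM x; rewrite /walk_step normrM normfV (ger0_norm (_ : 0 <= 2 :> R))//.
  rewrite ler_pdivrMr// (le_trans (ler_normD _ _))// mulr_natr mulr2n.
  by rewrite lerD.
have wl g x y M : (forall c, `|g (x + c) - g (y + c)| <= M) ->
    `|walk_step r g x - walk_step r g y| <= M.
  move=> gM.
  have -> : walk_step r g x - walk_step r g y =
     ((g (x + r) - g (y + r)) + (g (x - r) - g (y - r))) / 2.
    by rewrite /walk_step; ring.
  rewrite normrM normfV (ger0_norm (_ : 0 <= 2 :> R))//.
  rewrite ler_pdivrMr// (le_trans (ler_normD _ _))// mulr_natr mulr2n.
  by rewrite lerD.
have ws g : supported B g -> supported (B + r) (walk_step r g).
  move=> sg x xB; rewrite /walk_step !sg ?addr0 ?mul0r//.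
    rewrite -(lerD2r r) (le_trans xB)// -{1}(subrK r x).
    by rewrite (le_trans (ler_normD _ _))// (ger0_norm r0).
  rewrite -(lerD2r r) (le_trans xB)// -{1}(addrK r x).
  by rewrite (le_trans (ler_normB _ _))// (ger0_norm r0).
split; [exact: wtd|exact: wtd| |exact: wb| |exact: wb|exact: ws|exact: ws].
- move=> x y; apply: wl => c.
  by rewrite (le_trans (hv _ _))// (_ : x + c - (y + c) = x - y)//; ring.
- move=> x y; apply: wl => c.
  by rewrite (le_trans (l2 _ _))// (_ : x + c - (y + c) = x - y)//; ring.
Qed.

Lemma walk_iter_test L kappa M2 M3 M4 B r j v v2 v4 : 0 <= r ->
  test_function L kappa M2 M3 M4 B v v2 v4 ->
  test_function L kappa M2 M3 M4 (B + j%:R * r) (iter j (walk_step r) v)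
    (iter j (walk_step r) v2) (iter j (walk_step r) v4).
Proof.
move=> r0 tv; elim: j => [|j ih]; first by rewrite mul0r addr0.
rewrite -addn1 natrD mulrDl mul1r addrA addn1; exact: walk_step_test.
Qed.

Lemma walk_step_increment L kappa M2 M3 M4 B r v v2 v4 x : 0 <= r ->
  test_function L kappa M2 M3 M4 B v v2 v4 ->
  `|walk_step r v x - v x - r ^+ 2 / 2 * v2 x| <= r ^+ 3 * M3.
Proof.
move=> r0 [[[v1 d1 d2] _] _ _ _ l2 _ _ _].
have M30 : 0 <= M3 by have := l2 1 0; rewrite subr0 normr1 mulr1; exact: le_trans.
have := @second_difference _ v v1 v2 x r (v2 x) (M3 * r) d1 d2 r0.
have -> : walk_step r v x - v x - r ^+ 2 / 2 * v2 x =
  (v (x + r) + v (x - r) - 2 * v x - r ^+ 2 * v2 x) / 2 by rewrite /walk_step; field.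
move=> /(_ _) h; rewrite normrM normfV (ger0_norm (_ : 0 <= 2 :> R))// ler_pdivrMr//.
apply: (le_trans (h _)); last by rewrite le_eqVlt; apply/orP; left; apply/eqP; ring.
by move=> y yx; rewrite (le_trans (l2 _ _))// ler_wpM2l.
Qed.

Lemma walk_step_increment2 L kappa M2 M3 M4 B r v v2 v4 x : 0 <= r ->
  test_function L kappa M2 M3 M4 B v v2 v4 ->
  `|walk_step r v2 x - v2 x| <= r ^+ 2 * M4.
Proof.
move=> r0 [_ [[v3 d3 d4] _] _ _ _ b4 _ _].
have := @second_difference _ v2 v3 v4 x r 0 M4 d3 d4 r0.
have -> : walk_step r v2 x - v2 x = (v2 (x + r) + v2 (x - r) - 2 * v2 x) / 2.
  by rewrite /walk_step; field.
rewrite mulr0 subr0 normrM normfV (ger0_norm (_ : 0 <= 2 :> R))// ler_pdivrMr//.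
move=> h; apply: (le_trans (h _)); first by move=> y _; rewrite subr0.
by rewrite le_eqVlt; apply/orP; left; apply/eqP; ring.
Qed.

End mollification.

(** * The diffusion against the walk *)

Section comparison.
Context {R : realType}.

Lemma continuous_supported_nice (B : R) (f : R -> R) : continuous f ->
  supported B f -> nice f.
Proof.
move=> cf sf; split.
  exact: continuous_measurable_fun.
have BB : - `|B| <= `|B| by rewrite (le_trans (_ : _ <= 0))// oppr_le0.
have cn : {within `[- `|B|, `|B|], continuous (fun x => `|f x|)}.
  apply: continuous_subspaceT => x.
  by apply: (@continuous_comp _ _ _ f Num.norm); [exact: cf|exact: norm_continuous].
have [c _ hc] := EVT_max BB cn.
exists `|f c| => y; have [yB|By] := ltP `|y| `|B|.
  by apply: hc; rewrite in_itv/= -ler_norml ltW.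
by rewrite sf ?normr0// (le_trans (ler_norm B)).
Qed.

Lemma test_function_nice (L kappa M2 M3 M4 B : R) (v v2 v4 : R -> R) :
  test_function L kappa M2 M3 M4 B v v2 v4 -> nice v /\ nice v2.
Proof.
move=> tv; split.
  exact: continuous_supported_nice (twice_derivable_continuous (test_twice tv))
    (test_supported tv).
exact: continuous_supported_nice (twice_derivable_continuous (test_fourth tv))
    (test_supported2 tv).
Qed.

Lemma cutoff_continuous (r : R) : continuous (cutoff r).
Proof. by have [c1 [c2 [d1 _ _ _ _]]] := cutoff_twice_derivable r; exact: is_deriv_continuous d1. Qed.

Lemma cutoff_nice (r : R) : 0 < r -> nice (cutoff r).
Proof.
move=> r0; apply: (continuous_supported_nice (B := r)).
  exact: cutoff_continuous.
by move=> x; exact: cutoff_out.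
Qed.

Section telescope.
Context {S : set R} (X : markov_process S).
Local Notation T := (semigroup X).

(** Lindeberg's replacement argument. The one-step errors are only controlled up
to a weight [W], whose mean along the process is bounded by [w]. *)
Lemma telescope (G : nat -> R -> R) (W : R -> R) (h eps w : R) (z : nat -> R)
    (k : nat) (a : R) : 0 <= h -> S a -> (forall j, nice (G j)) -> nice W ->
  (forall j, 0 <= z j) ->
  (forall j b, (j < k)%N -> S b -> `|T h (G j) b - G j.+1 b| <= eps + z j * W b) ->
  (forall s, 0 <= s -> s <= k%:R * h -> T s W a <= w) ->
  `|T (k%:R * h) (G 0%N) a - G k a| <= k%:R * eps + (\sum_(j < k) z j) * w.
Proof.
move=> h0 Sa nG nW z0 step hw.
suff main i : (i <= k)%N -> `|T (k%:R * h) (G 0%N) a - T ((k - i)%:R * h) (G i) a|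
    <= i%:R * eps + (\sum_(j < i) z j) * w.
  by have := main k (leqnn k); rewrite subnn mul0r semigroup0.
elim: i => [_|i ih ik].
  by rewrite subn0 subrr normr0 mul0r big_ord0 mul0r addr0.
have s0 : 0 <= (k - i.+1)%:R * h by rewrite mulr_ge0.
have nu : nice (cst eps \+ (z i \*o W)) by apply: niceD; [exact: nice_cst|exact: niceZ].
have := semigroup_chain_norm s0 h0 Sa (nG i) (nG i.+1) nu (step i ^~ ik).
rewrite semigroupD//; [|exact: nice_cst|exact: niceZ].
rewrite semigroup_cst// semigroupZ//.
have -> : (k - i.+1)%:R * h + h = (k - i)%:R * h.
  by rewrite -[(k - i)%N](@prednK _) ?subn_gt0// -subnS -[in RHS]addn1 natrD mulrDl mul1r.
move=> /le_trans/(_ (_ : _ <= eps + z i * w)) st.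
have {}st := st _.
rewrite big_ord_recr/= -[in leRHS]addn1 natrD.
have -> : (i%:R + 1%:R) * eps + (\sum_(j < i) z j + z i) * w =
  (i%:R * eps + (\sum_(j < i) z j) * w) + (eps + z i * w) by ring.
set A := T (k%:R * h) _ _ in ih *; set A' := T ((k - i)%:R * h) _ _ in ih st *.
have -> : A - T ((k - i.+1)%:R * h) (G i.+1) a =
  (A - A') + (A' - T ((k - i.+1)%:R * h) (G i.+1) a) by ring.
rewrite (le_trans (ler_normD _ _))// lerD//; first exact: ih (ltnW ik).
apply: st; rewrite lerD2l ler_wpM2l// hw// ler_wpM2r// ler_nat; exact: leq_subr.
Qed.

(** The mass outside of the ball of radius [r] is at most [1 - T_t (cutoff r)],
and the cutoff function is almost harmonic, with defect [O(r ^ -2)]. *)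
Lemma truncation_error (f : R -> R) (L r t a : R) : nice f ->
  (forall x, `|f x| <= L) -> 0 < r -> 0 <= t -> S a ->
  `|T t (cutoff r) a - cutoff r a| <= 60 * t / r ^+ 2 ->
  `|T t f a - T t (f \* cutoff r) a| <= L * ((3 * a ^+ 2 + 60 * t) / r ^+ 2).
Proof.
move=> nf fL r0 t0 Sa hc.
have nc := cutoff_nice r0.
have nfc : nice (f \* cutoff r) by exact: niceM.
have L0 : 0 <= L by exact: le_trans (fL 0).
have nm1 : nice (-1 \*o (f \* cutoff r)) by exact: niceZ.
have -> : T t f a - T t (f \* cutoff r) a = T t (f \+ (-1 \*o (f \* cutoff r))) a.
  by rewrite semigroupD// semigroupZ// mulN1r.
have nu : nice (L \*o (cst 1 \+ (-1 \*o cutoff r))).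
  by apply: niceZ; apply: niceD; [exact: nice_cst|exact: niceZ].
apply: (le_trans (@semigroup_norm_le _ _ X t a _ _ t0 _ nu _)).
- exact: niceD.
- move=> y _ /=.
  have -> : f y + -1 * (f y * cutoff r y) = f y * (1 - cutoff r y) by ring.
  rewrite normrM mulN1r ler_pM// ger0_norm// subr_ge0; exact: cutoff_le1.
rewrite semigroupZ//; last by apply: niceD; [exact: nice_cst|exact: niceZ].
rewrite ler_wpM2l// semigroupD//; [|exact: nice_cst|exact: niceZ].
rewrite semigroup_cst// semigroupZ// mulN1r.
rewrite (mulrDl (3 * a ^+ 2)).
have := cutoff_near1 r a.
move: hc; rewrite ler_norml => /andP[+ _].
set x1 := _ / r ^+ 2; set x2 := _ / r ^+ 2; lra.
Qed.

End telescope.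

Section diffusion.
Context (X : markov_process [set: R]) (c : R).
Hypothesis c01 : 0 <= c <= 1.
Hypothesis genX : has_generator X [set g | C2 g /\ bounded_support g]
    (fun g x => c * derive1n 2 g x).
Local Notation T := (semigroup X).

Lemma diffusion_lipschitz (g g2 : R -> R) (B M s a : R) :
  twice_derivable g g2 -> supported B g -> (forall x, `|g2 x| <= M) -> 0 <= s ->
  `|T s g a - g a| <= s * M.
Proof.
move=> tg sg gM s0; have [C2g E] := C2_twice_derivable tg.
apply: (semigroup_lipschitz genX) => //.
- by split => //; exact: supported_bounded_support sg.
- exact: continuous_supported_nice (twice_derivable_continuous tg) sg.
- move=> b _; rewrite E normrM; case/andP: c01 => c0 c1.
  by rewrite (ger0_norm c0) (le_trans _ (gM b))// ler_piMl.
Qed.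

Lemma diffusion_cutoff (r t a : R) : 0 < r -> 0 <= t ->
  `|T t (cutoff r) a - cutoff r a| <= 60 * t / r ^+ 2.
Proof.
move=> r0 t0; have [c1 [c2 [d1 d2 cc2 _ b2]]] := cutoff_twice_derivable r.
have tc : twice_derivable (cutoff r) c2 by split => //; exists c1.
have sc : supported r (cutoff r) by move=> x; exact: cutoff_out.
apply: (le_trans (diffusion_lipschitz a tc sc b2 t0)).
rewrite mulrA ler_pM2r ?invr_gt0 ?exprn_gt0// mulrC ler_wpM2r//; lra.
Qed.

(** Both [v] and its image [c v''] under the generator are admissible test
functions, which is what requires four derivatives. *)
Lemma diffusion_increment (L kappa M2 M3 M4 B : R) (v v2 v4 : R -> R) (h a : R) :
  test_function L kappa M2 M3 M4 B v v2 v4 -> 0 <= h ->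
  `|T h v a - v a - h * (c * v2 a)| <= h * (h * M4).
Proof.
move=> tv h0; have [nv nv2] := test_function_nice tv.
have [C2v Ev] := C2_twice_derivable (test_twice tv).
case/andP: (c01) => c0 c1.
have := @generator_increment _ _ X _ _ v (c \*o v2) 0 (h * M4) h genX _ nv _ h0.
rewrite add0r; apply => //.
- by split => //; exact: supported_bounded_support (test_supported tv).
- exact: niceZ.
- by move=> b _; rewrite Ev subrr normr0.
- move=> s b s0 sh _; rewrite semigroupZ//= -mulrBr normrM (ger0_norm c0).
  have := diffusion_lipschitz b (test_fourth tv) (test_supported2 tv) (test_bound4 tv) s0.
  have M40 : 0 <= M4 by exact: le_trans (test_bound4 tv 0).
  move=> hl; rewrite (le_trans (ler_piMl _ c1))// (le_trans hl)//.
  by rewrite ler_wpM2r.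
Qed.

Lemma diffusion_walk (L kappa M2 M3 M4 B : R) (v v2 v4 : R -> R) (h r a : R) k :
  test_function L kappa M2 M3 M4 B v v2 v4 -> 0 <= h -> 0 <= r ->
  r ^+ 2 / 2 = h * c ->
  `|T (k%:R * h) v a - iter k (walk_step r) v a| <=
    k%:R * h * (h * M4 + 2 * r * M3).
Proof.
move=> tv h0 r0 rh; case/andP: (c01) => c0 c1.
have tj j := walk_iter_test j r0 tv.
have M30 : 0 <= M3.
  by have := test_lipschitz2 tv 1 0; rewrite subr0 normr1 mulr1; exact: le_trans.
have := @telescope _ X (fun j => iter j (walk_step r) v) (cst 0) h
  (h * (h * M4 + 2 * r * M3)) 0 (cst 0) k a h0 I.
rewrite mulr0 addr0 mulrA; apply => //.
- by move=> j; have [] := test_function_nice (tj j).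
- exact: nice_cst.
- move=> j b _ _; rewrite mul0r addr0.
  have := diffusion_increment b (tj j) h0.
  have := walk_step_increment b r0 (tj j).
  set vj := iter j (walk_step r) v; set vj2 := iter j (walk_step r) v2.
  rewrite -[iter j.+1 _ _]/(walk_step r vj) rh mulrA => w1 w2.
  have -> : T h vj b - walk_step r vj b = (T h vj b - vj b - h * c * vj2 b) -
    (walk_step r vj b - vj b - h * c * vj2 b) by ring.
  rewrite (le_trans (ler_normB _ _))// mulrDr lerD//.
  apply: (le_trans w1).
  have -> : h * (2 * r * M3) = 2 * h * r * M3 by ring.
  rewrite ler_wpM2r// exprSr ler_wpM2r//.
  have -> : r ^+ 2 = 2 * (h * c) by rewrite -rh; field.
  by rewrite ler_wpM2l// ler_piMr.
- by move=> s s0 _; rewrite semigroup_cst.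
Qed.

End diffusion.
End comparison.

(** * Second primitives of a noise *)

Section corrector.
Context {R : realType}.

(** The second primitive, on the half line, of the noise [xi] supported on
[{0, ..., N - 1}]: hinge functions have the Dirac masses at integers as
second differences. It makes sense at all reals, hence is continuous. *)
Definition hinge_sum (N : nat) (xi : nat -> R) (u : R) : R :=
  \sum_(z < N) xi z * Num.max (u - z%:R) 0.

(** The first primitive of the noise. *)
Definition partial_sum (N : nat) (xi : nat -> R) (i : nat) : R :=
  \sum_(z < N | (z <= i)%N) xi z.

Lemma hinge_second (z : nat) (y : int) :
  Num.max (y%:~R + 1 - z%:R) 0 + Num.max (y%:~R - 1 - z%:R) 0
  - 2 * Num.max (y%:~R - z%:R) 0 = (y == z%:Z)%:R :> R.
Proof.
have e (a : int) : Num.max (a%:~R) 0 = (Num.max a 0)%:~R :> R.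
  by case: (leP a 0) => a0; [rewrite max_r ?lerz0|rewrite max_l ?ler0z// ltW].
have -> : y%:~R + 1 - z%:R = (y + 1 - z%:Z)%:~R :> R by rewrite !rmorphB rmorphD.
have -> : y%:~R - 1 - z%:R = (y - 1 - z%:Z)%:~R :> R by rewrite !rmorphB.
have -> : y%:~R - z%:R = (y - z%:Z)%:~R :> R by rewrite !rmorphB.
rewrite !e -[2]/(2%:~R) -rmorphM -rmorphD -rmorphB.
rewrite [RHS](_ : _ = ((y == z%:Z) : nat)%:Z%:~R)//; congr (_%:~R).
by case: eqP => [->|] /=; lia.
Qed.

Lemma hinge_sum_second N xi (y : int) :
  hinge_sum N xi (y%:~R + 1) + hinge_sum N xi (y%:~R - 1)
  - 2 * hinge_sum N xi y%:~R = \sum_(z < N) xi z * (y == z%:Z)%:R.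
Proof.
rewrite /hinge_sum mulr_sumr -sumrN -!big_split/=; apply: eq_bigr => z _.
by rewrite -hinge_second; ring.
Qed.

Lemma hinge_sum_nat N xi (m : nat) :
  hinge_sum N xi m%:R = \sum_(i < m) partial_sum N xi i.
Proof.
elim: m => [|m ih].
  by rewrite big_ord0; apply: big1 => z _; rewrite max_r ?mulr0// sub0r oppr_le0.
rewrite big_ord_recr/= -ih /hinge_sum /partial_sum [X in _ + X]big_mkcond.
rewrite -big_split/=; apply: eq_bigr => z _.
rewrite -addn1 natrD; have [zm|mz] := leqP z m.
  have : z%:R <= m%:R :> R by rewrite ler_nat.
  by move=> h; rewrite !max_l; [ring|lra|lra].
have : m%:R + 1 <= z%:R :> R by rewrite -[1]/(1%:R) -natrD ler_nat addn1.
by move=> h; rewrite !max_r; [ring|lra|lra].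
Qed.

Lemma hinge_sum_npos N xi (u : R) : u <= 0 -> hinge_sum N xi u = 0.
Proof.
move=> u0; apply: big1 => z _; rewrite max_r ?mulr0// subr_le0.
by rewrite (le_trans u0).
Qed.

Lemma hinge_sum_lipschitz N xi (u u' : R) :
  `|hinge_sum N xi u - hinge_sum N xi u'| <= (\sum_(z < N) `|xi z|) * `|u - u'|.
Proof.
rewrite /hinge_sum -sumrB mulr_suml (le_trans (ler_norm_sum _ _ _))//.
apply: ler_sum => z _; rewrite -mulrBr normrM ler_wpM2l//.
have e : u - u' = (u - z%:R) - (u' - z%:R) by ring.
rewrite e; set a := u - _; set b := u' - _.
case: (leP a 0) => a0; case: (leP b 0) => b0.
- by rewrite subrr normr0.
- rewrite sub0r normrN (gtr0_norm b0) ler0_norm; lra.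
- rewrite subr0 (gtr0_norm a0) ger0_norm; lra.
- by [].
Qed.

End corrector.

Section corrector_chain.
Context {R : realType} (c : R) (tau : int -> R) (n : nat).
Hypothesis n0 : (0 < n)%N.
Implicit Types (D : R -> R) (N : nat).

(** On the site [z], the generator of the chain applied to [v] deviates from
[c v''] by the factor [1 / tau z - c]; multiplying by [tau z], the corrector has
to absorb [(c tau z - 1) v'']. *)
Definition noise_right D (z : nat) : R := (c * tau z%:Z - 1) * D (z%:R / n%:R).

(** The sites [- z]. The factor [z != 0] prevents the origin from being counted
on both sides. *)
Definition noise_left D (z : nat) : R :=
  (z != 0%N)%:R * ((c * tau (- z%:Z) - 1) * D (- (z%:R / n%:R))).

(** The solution of [n ^ 2 Delta psi = (c tau - 1) D] which vanishes at the
origin; the two half lines are treated separately, so that the value at a site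
only involves the noise between that site and the origin. *)
Definition corrector N D (x : R) : R := n%:R ^- 2 *
  (hinge_sum N (noise_right D) (n%:R * x) + hinge_sum N (noise_left D) (- (n%:R * x))).

(** The weighted [l^1] norm of the discrete gradient of the corrector. A second
primitive is bounded by the sum of the absolute values of the first one, so
this sum controls the corrector simultaneously at all sites, and its mean is
computed term by term. *)
Definition corrector_size N N' D : R := n%:R ^- 2 * \sum_(i < N')
  (`|partial_sum N (noise_right D) i| + `|partial_sum N (noise_left D) i|) /
  (1 + (i.+1%:R / n%:R) ^+ 2).

(** A crude Lipschitz constant of the corrector. It has no decay in [n], and
only enters errors that are divided by the radius of the cutoff. *)
Definition noise_mass N : R := n%:R^-1 *
  \sum_(z < N) (`|c * tau z%:Z - 1| + `|c * tau (- z%:Z) - 1|).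

Let nR : 0 < n%:R :> R. Proof. by rewrite ltr0n. Qed.

Let nn0 : n%:R != 0 :> R. Proof. exact: lt0r_neq0. Qed.

Lemma corrector_size_ge0 N N' D : 0 <= corrector_size N N' D.
Proof.
apply: mulr_ge0; first by rewrite invr_ge0 exprn_ge0.
by apply: sumr_ge0 => i _; rewrite divr_ge0 ?addr_ge0 ?sqr_ge0.
Qed.

Lemma noise_mass_ge0 N : 0 <= noise_mass N.
Proof. by apply: mulr_ge0; rewrite ?invr_ge0//; apply: sumr_ge0 => i _; rewrite addr_ge0. Qed.

Let sum_pick N (xi : nat -> R) (m : nat) :
  \sum_(z < N) xi z * (m%:Z == z%:Z)%:R = (m < N)%:R * xi m.
Proof.
have [mN|Nm] := ltnP m N; last first.
  rewrite mul0r; apply: big1 => z _.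
  by rewrite eqz_nat gtn_eqF ?mulr0// (leq_trans (ltn_ord z)).
rewrite (bigD1 (Ordinal mN))//= eqxx mulr1 big1 ?addr0 ?mul1r// => z zm.
rewrite eqz_nat; case: eqP => [mz|]; last by rewrite mulr0.
by case/eqP: zm; apply/val_inj.
Qed.

Let sum_pick_neg N (xi : nat -> R) (m : nat) :
  \sum_(z < N) xi z * (Negz m == z%:Z)%:R = 0.
Proof. by apply: big1 => z _; rewrite mulr0. Qed.

Lemma corrector_second N D (y : int) (B : R) : supported B D -> B <= N%:R / n%:R ->
  let a := y%:~R / n%:R in
  n%:R ^+ 2 * (corrector N D (a + n%:R^-1) + corrector N D (a - n%:R^-1)
    - 2 * corrector N D a) = (c * tau y - 1) * D a.
Proof.
move=> sD BN a.
have e1 : n%:R * (a + n%:R^-1) = y%:~R + 1 by rewrite /a; field.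
have e2 : n%:R * (a - n%:R^-1) = y%:~R - 1 by rewrite /a; field.
have e3 : n%:R * a = y%:~R by rewrite /a; field.
rewrite /corrector e1 e2 e3.
have -> : - (y%:~R + 1) = (- y)%:~R - 1 :> R by rewrite rmorphN/=; ring.
have -> : - (y%:~R - 1) = (- y)%:~R + 1 :> R by rewrite rmorphN/=; ring.
have -> : - y%:~R = (- y)%:~R :> R by rewrite rmorphN.
set hr := hinge_sum N (noise_right D); set hl := hinge_sum N (noise_left D).
have -> : n%:R ^+ 2 * (n%:R ^- 2 * (hr (y%:~R + 1) + hl ((- y)%:~R - 1)) +
   n%:R ^- 2 * (hr (y%:~R - 1) + hl ((- y)%:~R + 1)) -
   2 * (n%:R ^- 2 * (hr y%:~R + hl (- y)%:~R))) =
   (hr (y%:~R + 1) + hr (y%:~R - 1) - 2 * hr y%:~R) +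
   (hl ((- y)%:~R + 1) + hl ((- y)%:~R - 1) - 2 * hl (- y)%:~R) by field.
rewrite /hr /hl !hinge_sum_second.
have big (m : nat) : (N <= m)%N -> B <= m%:R / n%:R.
  by move=> Nm; rewrite (le_trans BN)// ler_pM2r ?invr_gt0// ler_nat.
(* Beyond the last hinge there is nothing to correct, as [D] vanishes. *)
have far (m : nat) (e : R) : (e = m%:R / n%:R \/ e = - (m%:R / n%:R)) ->
    D e = (m < N)%:R * D e.
  move=> he; have [|/big Bm] := ltnP m N; first by rewrite mul1r.
  rewrite mul0r sD//; case: he => ->; rewrite ?normrN ger0_norm ?divr_ge0//.
case: y @a e1 e2 e3 => m a _ _ _.
  rewrite sum_pick; have -> : \sum_(z < N) noise_left D z * (- Posz m == z%:Z)%:R = 0.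
    case: m @a => [|m] a; last by rewrite -NegzE sum_pick_neg.
    by rewrite oppr0 sum_pick /noise_left eqxx mul0r mulr0.
  rewrite addr0 /noise_right -/a [D a in RHS](far m)//; last by left.
  by rewrite -[a]/(m%:R / n%:R); ring.
rewrite sum_pick_neg add0r NegzE opprK sum_pick /noise_left/= mul1r.
have aE : a = - (m.+1%:R / n%:R) by rewrite /a NegzE rmorphN mulNr.
by rewrite -aE [in RHS](far m.+1 a (or_intror aE)); ring.
Qed.

(** The weights are increasing away from the origin, so the largest one on the
way to [y] is at most [1 + (y / n) ^ 2]. *)
Lemma corrector_bound N N' D (y : int) : (`|y| <= N')%N ->
  `|corrector N D (y%:~R / n%:R)| <=
  (1 + (y%:~R / n%:R) ^+ 2) * corrector_size N N' D.
Proof.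
have key (xi : nat -> R) (m : nat) : (m <= N')%N ->
    `|hinge_sum N xi m%:R| <= (1 + (m%:R / n%:R) ^+ 2) *
     \sum_(i < N') `|partial_sum N xi i| / (1 + (i.+1%:R / n%:R) ^+ 2).
  move=> mN; rewrite hinge_sum_nat (le_trans (ler_norm_sum _ _ _))//.
  rewrite (big_ord_widen _ (fun i => `|partial_sum N xi i|) mN) big_mkcond mulr_sumr.
  apply: ler_sum => i _; case: ifPn => [im|_]; last first.
    by rewrite mulr_ge0 ?addr_ge0 ?sqr_ge0// divr_ge0 ?addr_ge0 ?sqr_ge0.
  have pos (u : R) : 0 < 1 + u ^+ 2 by rewrite ltr_pwDl ?sqr_ge0.
  rewrite mulrCA ler_peMr// ler_pdivlMr ?mul1r// lerD2l.
  by rewrite ler_sqr ?nnegrE ?divr_ge0// ler_pM2r ?invr_gt0// ler_nat.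
have split_size : corrector_size N N' D = n%:R ^- 2 *
    (\sum_(i < N') `|partial_sum N (noise_right D) i| / (1 + (i.+1%:R / n%:R) ^+ 2) +
     \sum_(i < N') `|partial_sum N (noise_left D) i| / (1 + (i.+1%:R / n%:R) ^+ 2)).
  by rewrite -big_split; congr (_ * _); apply: eq_bigr => i _; rewrite mulrDl.
move=> yN; rewrite /corrector split_size [n%:R * _]mulrC divfK//.
rewrite normrM ger0_norm ?invr_ge0 ?exprn_ge0// [leRHS]mulrCA.
rewrite ler_wpM2l ?invr_ge0 ?exprn_ge0//.
have s0 (xi : nat -> R) : 0 <= (1 + (y%:~R / n%:R) ^+ 2) *
     \sum_(i < N') `|partial_sum N xi i| / (1 + (i.+1%:R / n%:R) ^+ 2).
  apply: mulr_ge0; first by rewrite addr_ge0 ?sqr_ge0.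
  by apply: sumr_ge0 => i _; rewrite divr_ge0 ?addr_ge0 ?sqr_ge0.
rewrite mulrDr (le_trans (ler_normD _ _))// lerD//.
  have [y0|y0] := leP 0 y; last by rewrite hinge_sum_npos ?normr0// lerz0 ltW.
  by case: y y0 yN {s0} => // m _ mN; apply: (key (noise_right D) m).
have [y0|y0] := leP 0 y.
  by rewrite hinge_sum_npos ?normr0// oppr_le0 ler0z.
case: y y0 yN {s0} => // m _ mN.
rewrite NegzE rmorphN/= opprK mulNr sqrrN; exact: (key (noise_left D) m.+1).
Qed.

Lemma corrector_lipschitz N D M x x' : (forall u, `|D u| <= M) ->
  `|corrector N D x - corrector N D x'| <= M * noise_mass N * `|x - x'|.
Proof.
move=> DM.
have e : corrector N D x - corrector N D x' = n%:R ^- 2 *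
   ((hinge_sum N (noise_right D) (n%:R * x) - hinge_sum N (noise_right D) (n%:R * x')) +
    (hinge_sum N (noise_left D) (- (n%:R * x)) - hinge_sum N (noise_left D) (- (n%:R * x')))).
  by rewrite /corrector; ring.
have l1 := hinge_sum_lipschitz N (noise_right D) (n%:R * x) (n%:R * x').
have l2 := hinge_sum_lipschitz N (noise_left D) (- (n%:R * x)) (- (n%:R * x')).
have nx : `|n%:R * x - n%:R * x'| = n%:R * `|x - x'|.
  by rewrite -mulrBr normrM ger0_norm.
have nx' : `|- (n%:R * x) - - (n%:R * x')| = n%:R * `|x - x'|.
  by rewrite opprK addrC -mulrBr normrM ger0_norm// distrC.
rewrite nx in l1; rewrite nx' in l2.
have b1 : \sum_(z < N) `|noise_right D z| <= M * \sum_(z < N) `|c * tau z%:Z - 1|.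
  rewrite mulr_sumr; apply: ler_sum => z _.
  by rewrite /noise_right normrM mulrC ler_wpM2r.
have b2 : \sum_(z < N) `|noise_left D z| <= M * \sum_(z < N) `|c * tau (- z%:Z) - 1|.
  rewrite mulr_sumr; apply: ler_sum => z _.
  rewrite /noise_left; case: (z != 0%N :> nat); rewrite ?mul0r ?mul1r ?normr0.
    by rewrite normrM mulrC ler_wpM2r.
  by rewrite mulr_ge0// (le_trans _ (DM 0)).
rewrite e normrM ger0_norm ?invr_ge0 ?exprn_ge0// ler_pdivrMl ?exprn_gt0//.
apply: (le_trans (ler_normD _ _)); apply: (le_trans (lerD l1 l2)).
rewrite -mulrDl /noise_mass big_split/=.
set s1 := \sum_(z < N) `|c * tau z%:Z - 1| in b1 *.
set s2 := \sum_(z < N) `|c * tau (- z%:Z) - 1| in b2 *.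
have -> : n%:R ^+ 2 * (M * (n%:R^-1 * (s1 + s2)) * `|x - x'|) =
  (M * s1 + M * s2) * (n%:R * `|x - x'|) by field.
by rewrite ler_wpM2r ?mulr_ge0// lerD.
Qed.

Lemma corrector0 N D : corrector N D 0 = 0.
Proof. by rewrite /corrector mulr0 oppr0 !hinge_sum_npos// addr0 mulr0. Qed.

Lemma correctorB N D D' x :
  corrector N D x - corrector N D' x = corrector N (fun u => D u - D' u) x.
Proof.
have e (xi xi' xi'' : nat -> R) u : (forall z, xi z - xi' z = xi'' z) ->
    hinge_sum N xi u - hinge_sum N xi' u = hinge_sum N xi'' u.
  by move=> h; rewrite /hinge_sum -sumrB; apply: eq_bigr => z _; rewrite -mulrBl h.
rewrite /corrector -mulrBr opprD addrACA; congr (_ * (_ + _)); apply: e => z.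
  by rewrite /noise_right; ring.
by rewrite /noise_left; ring.
Qed.

Lemma corrector_continuous N D M : (forall u, `|D u| <= M) ->
  continuous (corrector N D).
Proof.
move=> DM; apply: (@holder_continuous _ (M * noise_mass N) 1) => //.
  by rewrite mulr_ge0 ?noise_mass_ge0// (le_trans _ (DM 0)).
by move=> u u'; rewrite powRr1//; exact: corrector_lipschitz.
Qed.

End corrector_chain.

(** * The trap chain in a fixed environment *)

Section chain.
Context {R : realType} (c : R) (tau : int -> R) (n : nat).
Context (X : markov_process (lattice R n)).
Hypothesis n0 : (0 < n)%N.
Hypothesis c01 : 0 <= c <= 1.
Hypothesis tau1 : forall x, 1 <= tau x.
Hypothesis genX : is_trap_chain tau X.
Local Notation T := (semigroup X).
Local Notation S := (lattice R n).
Local Notation s := (n%:R^-1 : R).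

Let nR : 0 < n%:R :> R. Proof. by rewrite ltr0n. Qed.
Let nn0 : n%:R != 0 :> R. Proof. exact: lt0r_neq0. Qed.
Let s0 : 0 < s. Proof. by rewrite invr_gt0. Qed.
Let s1 : s <= 1. Proof. by rewrite invf_le1// ler1n. Qed.

Definition lap (g : R -> R) (a : R) : R := n%:R ^+ 2 * (g (a + s) + g (a - s) - 2 * g a).

Lemma trap_generatorE a : S a -> exists2 y : int, a = y%:~R / n%:R &
  forall g, trap_generator n tau g a = lap g a / tau y.
Proof.
move=> [y _ <-]; exists y => // g.
rewrite /trap_generator /lap.
have -> : n%:R * (y%:~R / n%:R) = y%:~R :> R by field.
rewrite intrKfloor big_cons big_seq1.
have -> : (y - 1)%:~R / n%:R = y%:~R / n%:R - s :> R by rewrite rmorphB/= mulrBl mul1r.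
have -> : (y + 1)%:~R / n%:R = y%:~R / n%:R + s :> R by rewrite rmorphD/= mulrDl mul1r.
by field; rewrite lt0r_neq0 ?(lt_le_trans _ (tau1 y)).
Qed.

Let tau_div x y : `|x / tau y| <= `|x|.
Proof.
have ty : 0 < tau y by exact: lt_le_trans (tau1 y).
by rewrite normrM normfV (gtr0_norm ty) ler_piMr// invf_le1.
Qed.

Lemma chain_lipschitz (g : R -> R) (M u : R) : bounded_support g -> nice g ->
  0 <= u -> (forall a, `|lap g a| <= M) ->
  forall a, S a -> `|T u g a - g a| <= u * M.
Proof.
move=> bg ng u0 gM a Sa; apply: (semigroup_lipschitz genX) => // b Sb.
have [y _ ->] := trap_generatorE Sb.
exact: le_trans (tau_div _ _) (gM _).
Qed.

Lemma lap_bound g g1 g2 (M q a : R) : is_deriv g g1 -> is_deriv g1 g2 ->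
  (forall b, `|b - a| <= s -> `|g2 b - q| <= M) -> `|lap g a - q| <= 2 * M.
Proof.
move=> d1 d2 gM; have := second_difference d1 d2 (ltW s0) gM.
have -> : lap g a - q = n%:R ^+ 2 * (g (a + s) + g (a - s) - 2 * g a - s ^+ 2 * q).
  by rewrite /lap; field.
move=> h; rewrite normrM ger0_norm ?exprn_ge0//.
apply: (le_trans (ler_wpM2l (exprn_ge0 _ (ltW nR)) h)).
by rewrite le_eqVlt; apply/orP; left; apply/eqP; field.
Qed.

Lemma lap_bound0 g g1 g2 (M a : R) : is_deriv g g1 -> is_deriv g1 g2 ->
  (forall b, `|g2 b| <= M) -> `|lap g a| <= 2 * M.
Proof.
move=> d1 d2 gM; rewrite -[lap g a]subr0; apply: lap_bound d1 d2 _ => b _.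
by rewrite subr0.
Qed.

Lemma lap_cutoff r a : `|lap (cutoff r) a| <= 60 / r ^+ 2.
Proof.
have [c1 [c2 [d1 d2 _ _ b2]]] := cutoff_twice_derivable r.
apply: (le_trans (lap_bound0 a d1 d2 b2)).
by rewrite mulrA -natrM.
Qed.

Lemma chain_cutoff (r t a : R) : 0 < r -> 0 <= t -> S a ->
  `|T t (cutoff r) a - cutoff r a| <= 60 * t / r ^+ 2.
Proof.
move=> r0 t0 Sa.
have bc : bounded_support (cutoff r).
  by apply: (@supported_bounded_support _ r) => x; exact: cutoff_out.
have := chain_lipschitz bc (cutoff_nice r0) t0 (lap_cutoff r) Sa.
by move/le_trans; apply; rewrite mulrA [60 * t]mulrC.
Qed.

(** The discrete Leibniz rule. The two cross terms are products of gradients, of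
order [La / r]; in the last term, [lap (cutoff r)] is of order [r ^ -2] and
[p] of order [La r]. *)
Lemma lap_cutoff_mul (r La : R) (p : R -> R) (a : R) : 1 <= r -> 0 <= La ->
  `|p (a + s) - p a| <= La * s -> `|p (a - s) - p a| <= La * s ->
  (`|a| <= 2 * r -> `|p a| <= La * (2 * r)) ->
  `|lap (cutoff r \* p) a - cutoff r a * lap p a| <= 132 * La / r.
Proof.
move=> r1 La0 p1 p2 pa.
have r0 : 0 < r by exact: lt_le_trans r1.
have [c1 [c2 [d1 d2 _ b1 b2]]] := cutoff_twice_derivable r.
have grad u v : `|cutoff r u - cutoff r v| <= 6 / r * `|u - v|.
  by apply: (lipschitz_deriv d1) => x; rewrite -[X in _ / X](gtr0_norm r0).
have g1 := grad (a + s) a; have g2 := grad (a - s) a.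
have e1 : `|a + s - a| = s by rewrite [a + s]addrC addrK gtr0_norm.
have e2 : `|a - s - a| = s by rewrite addrAC subrr sub0r normrN gtr0_norm.
rewrite e1 in g1; rewrite e2 in g2.
have -> : lap (cutoff r \* p) a - cutoff r a * lap p a =
  n%:R ^+ 2 * ((cutoff r (a + s) - cutoff r a) * (p (a + s) - p a)) +
  n%:R ^+ 2 * ((cutoff r (a - s) - cutoff r a) * (p (a - s) - p a)) +
  p a * lap (cutoff r) a by rewrite /lap /=; ring.
have n2 : 0 <= n%:R ^+ 2 :> R by exact: exprn_ge0.
have cross x y : `|x| <= 6 / r * s -> `|y| <= La * s ->
    `|n%:R ^+ 2 * (x * y)| <= 6 * La / r.
  move=> hx hy; rewrite normrM (ger0_norm n2) normrM.
  have h : `|x| * `|y| <= 6 / r * s * (La * s) by exact: ler_pM.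
  apply: (le_trans (ler_wpM2l n2 h)).
  rewrite le_eqVlt; apply/orP; left; apply/eqP; field.
  by rewrite nn0 lt0r_neq0.
have last : `|p a * lap (cutoff r) a| <= 120 * La / r.
  have [ar|ra] := leP `|a| (2 * r).
    rewrite normrM; apply: (le_trans (ler_pM _ _ (pa ar) (lap_cutoff r a))) => //.
    by rewrite le_eqVlt; apply/orP; left; apply/eqP; field; exact: lt0r_neq0.
  rewrite /lap !cutoff_out//; [|lra| |].
  - rewrite addr0 mulr0 subrr mulr0 mulr0 normr0.
    by apply: divr_ge0; [apply: mulr_ge0; [exact: ler0n|]|exact: ltW].
  - have := ler_normD (a - s) s; rewrite subrK (gtr0_norm s0); move: s1; lra.
  - have := ler_normB (a + s) s; rewrite addrK (gtr0_norm s0); move: s1; lra.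
have := cross _ _ g1 p1; have := cross _ _ g2 p2 => h2 h1.
apply: (le_trans (ler_normD _ _)).
have := le_trans (ler_normD _ _) (lerD h1 h2).
set z := `|_ + _| => hz; apply: (le_trans (lerD hz last)).
by rewrite le_eqVlt; apply/orP; left; apply/eqP; field; exact: lt0r_neq0.
Qed.

(** The growth [1 + x ^ 2] of the corrector, cut off to be a
test function of the generator. *)
Definition weight (r : R) : R -> R := cutoff r \* (fun x => 1 + x ^+ 2).

Lemma weight_supported r : 0 < r -> supported r (weight r).
Proof. by move=> r0 x rx; rewrite /weight/= cutoff_out ?mul0r. Qed.

Lemma weight_continuous r : continuous (weight r).
Proof.
move=> x; apply: cvgM; first exact: cutoff_continuous.
by apply: cvgD; [exact: cvg_cst|exact: exprn_continuous].
Qed.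

Lemma weight_nice r : 0 < r -> nice (weight r).
Proof.
by move=> r0; apply: continuous_supported_nice (weight_supported r0); exact: weight_continuous.
Qed.

(** The constant does not depend on the cutoff radius: it is [660 = 132 * 5]
from the Leibniz rule with gradient bound [5 r], plus [2] from the Laplacian of
[1 + x ^ 2]. *)
Lemma lap_weight r a : 1 <= r -> `|lap (weight r) a| <= 662.
Proof.
move=> r1; have r0 : 0 < r by exact: lt_le_trans r1.
have [ar|ra] := leP `|a| (2 * r); last first.
  rewrite /lap !weight_supported//; [|lra| |].
  - rewrite addr0 mulr0 subrr mulr0 normr0; exact: ler0n.
  - have := ler_normD (a - s) s; rewrite subrK (gtr0_norm s0); move: s1; lra.
  - have := ler_normB (a + s) s; rewrite addrK (gtr0_norm s0); move: s1; lra.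
pose w x : R := 1 + x ^+ 2.
have lw : lap w a = 2 by rewrite /lap /w; field.
have as_ : s <= r by exact: le_trans r1.
have r50 : 0 <= 5 * r by lra.
have h1 : `|w (a + s) - w a| <= 5 * r * s.
  have -> : w (a + s) - w a = (2 * a + s) * s by rewrite /w; ring.
  rewrite normrM (gtr0_norm s0); apply: ler_wpM2r; first exact: ltW.
  apply: (le_trans (ler_normD _ _)); rewrite normrM (gtr0_norm s0) ger0_norm//; lra.
have h2 : `|w (a - s) - w a| <= 5 * r * s.
  have -> : w (a - s) - w a = (s - 2 * a) * s by rewrite /w; ring.
  rewrite normrM (gtr0_norm s0); apply: ler_wpM2r; first exact: ltW.
  apply: (le_trans (ler_normB _ _)); rewrite normrM (gtr0_norm s0) ger0_norm//; lra.
have h3 : `|a| <= 2 * r -> `|w a| <= 5 * r * (2 * r).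
  move=> _; rewrite ger0_norm ?addr_ge0 ?sqr_ge0//.
  have : a ^+ 2 <= (2 * r) ^+ 2.
    by rewrite -real_normK ?num_real// ler_sqr ?nnegrE//; lra.
  have : 1 <= r ^+ 2 by exact: exprn_ege1.
  rewrite /w exprMn; set r2 := r ^+ 2; rewrite (_ : 5 * r * (2 * r) = 10 * r2).
    lra.
  by rewrite /r2; ring.
have := lap_cutoff_mul r1 r50 h1 h2 h3.
rewrite lw (_ : 132 * (5 * r) / r = 660); last by field; exact: lt0r_neq0.
rewrite -/(weight r) => h.
have -> : lap (weight r) a = (lap (weight r) a - cutoff r a * 2) + cutoff r a * 2.
  by ring.
rewrite (le_trans (ler_normD _ _))// (_ : 662 = 660 + 2)//; last by rewrite -natrD.
rewrite lerD// normrM (ger0_norm (cutoff_ge0 _ _)) (ger0_norm (_ : 0 <= 2 :> R))//.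
by rewrite ler_piMl// cutoff_le1.
Qed.

(** The chain spreads at most diffusively whatever the environment, since traps
at least [1] only slow it down. *)
Lemma chain_weight (r t a : R) : 1 <= r -> 0 <= t -> S a ->
  T t (weight r) a <= 1 + a ^+ 2 + 662 * t.
Proof.
move=> r1 t0 Sa; have r0 : 0 < r by exact: lt_le_trans r1.
have := chain_lipschitz (supported_bounded_support (weight_supported r0))
  (weight_nice r0) t0 (fun a => lap_weight a r1) Sa.
rewrite ler_norml => /andP[_].
have : weight r a <= 1 + a ^+ 2.
  by rewrite /weight/= ler_piMl ?cutoff_le1// addr_ge0 ?sqr_ge0.
rewrite [t * _]mulrC; lra.
Qed.

End chain.

Section chain_walk.
Context {R : realType} (c : R) (tau : int -> R) (n : nat).
Context (X : markov_process (lattice R n)).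
Hypothesis n0 : (0 < n)%N.
Hypothesis c01 : 0 <= c <= 1.
Hypothesis tau1 : forall x, 1 <= tau x.
Hypothesis genX : is_trap_chain tau X.
Local Notation T := (semigroup X).
Local Notation S := (lattice R n).
Local Notation s := (n%:R^-1 : R).
Local Notation psi := (corrector c tau n).
Local Notation mass := (noise_mass c tau n).
Local Notation size := (corrector_size c tau n).

Let nR : 0 < n%:R :> R. Proof. by rewrite ltr0n. Qed.
Let s0 : 0 < s. Proof. by rewrite invr_gt0. Qed.

Definition corrected N rho (v v2 : R -> R) : R -> R := v \+ (cutoff rho \* psi N v2).

Lemma corrected_nice N rho L kappa M2 M3 M4 B v v2 v4 : 0 < rho ->
  test_function L kappa M2 M3 M4 B v v2 v4 ->
  nice (cutoff rho \* psi N v2) /\ bounded_support (cutoff rho \* psi N v2).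
Proof.
move=> r0 tv.
have sc : supported rho (cutoff rho \* psi N v2).
  by move=> x rx; rewrite /= cutoff_out ?mul0r.
split; last exact: supported_bounded_support sc.
apply: continuous_supported_nice sc => x.
have cpsi : {for x, continuous (psi N v2)}.
  exact: (corrector_continuous n0 (test_bound2 tv)).
exact: (cvgM (@cutoff_continuous _ rho x) cpsi).
Qed.

(** Homogenization: on the site [y] the generator gives
[v'' / tau y + (c tau y - 1) v'' / tau y = c v'']. What remains is the
discretization of [v''] and the effect of the cutoff, both on the support of
[v''], where the cutoff is close to [1], and through the Leibniz rule. *)
Lemma corrected_generator N rho L kappa M2 M3 M4 B v v2 v4 a : 1 <= rho ->
  test_function L kappa M2 M3 M4 B v v2 v4 -> 0 <= B -> B <= N%:R / n%:R -> S a ->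
  `|trap_generator n tau (corrected N rho v v2) a - c * v2 a| <=
    2 * (M3 * s) + 3 * B ^+ 2 / rho ^+ 2 * M2 + 132 * (M2 * mass N) / rho.
Proof.
move=> r1 tv B0 BN Sa; have r0 : 0 < rho by exact: lt_le_trans r1.
have M20 : 0 <= M2 by exact: le_trans (test_bound2 tv 0).
have M30 : 0 <= M3.
  by have := test_lipschitz2 tv 1 0; rewrite subr0 normr1 mulr1; exact: le_trans.
have La0 : 0 <= M2 * mass N by rewrite mulr_ge0// noise_mass_ge0.
have lip x y := corrector_lipschitz c tau n0 N x y (test_bound2 tv).
have [y ay gE] := trap_generatorE n0 tau1 Sa; rewrite gE.
have second := corrector_second c tau n0 y (test_supported2 tv) BN.
rewrite -ay in second.
have {}second : lap n (psi N v2) a = (c * tau y - 1) * v2 a by exact: second.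
have leib := @lap_cutoff_mul _ n n0 rho (M2 * mass N) (psi N v2) a r1 La0.
have e1 : `|a + s - a| = s by rewrite [a + s]addrC addrK gtr0_norm.
have e2 : `|a - s - a| = s by rewrite addrAC subrr sub0r normrN gtr0_norm.
have h1 : `|psi N v2 (a + s) - psi N v2 a| <= M2 * mass N * s by rewrite -{2}e1 lip.
have h2 : `|psi N v2 (a - s) - psi N v2 a| <= M2 * mass N * s by rewrite -{2}e2 lip.
have h3 : `|a| <= 2 * rho -> `|psi N v2 a| <= M2 * mass N * (2 * rho).
  move=> ar; have := lip a 0; rewrite corrector0// !subr0 => /le_trans; apply.
  exact: ler_wpM2l.
have {leib h1 h2 h3} leib := leib h1 h2 h3.
have [[[v1 d1 d2] _] _ _ _ l2 _ _ _] := tv.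
have lv : `|lap n v a - v2 a| <= 2 * (M3 * s).
  apply: (lap_bound n0 d1 d2) => b ba.
  by apply: (le_trans (l2 b a)); rewrite ler_wpM2l.
set ty := tau y in second *; have ty1 : 1 <= ty by exact: tau1.
have ty0 : 0 < ty by exact: lt_le_trans ty1.
have -> : lap n (corrected N rho v v2) a / ty - c * v2 a =
  (lap n v a - v2 a) / ty + (cutoff rho a - 1) * ((c * ty - 1) * v2 a) / ty +
   (lap n (cutoff rho \* psi N v2) a - cutoff rho a * lap n (psi N v2) a) / ty.
  by rewrite second /lap /corrected /=; field; exact: lt0r_neq0.
have small x : `|x / ty| <= `|x|.
  by rewrite normrM normfV (gtr0_norm ty0) ler_piMr// invf_le1.
apply: (le_trans (ler_normD _ _)); apply: lerD; last exact: le_trans (small _) leib.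
apply: (le_trans (ler_normD _ _)); apply: lerD; first exact: le_trans (small _) lv.
have -> : (cutoff rho a - 1) * ((c * ty - 1) * v2 a) / ty =
   (cutoff rho a - 1) * v2 a * (c - ty^-1) by field; exact: lt0r_neq0.
have ct : `|c - ty^-1| <= 1.
  have : ty^-1 <= 1 by rewrite invf_le1.
  have : 0 < ty^-1 by rewrite invr_gt0.
  by case/andP: c01 => c0 c1 i0 i1; rewrite ler_norml; apply/andP; split; lra.
rewrite normrM.
have hq : 0 <= 3 * B ^+ 2 / rho ^+ 2 * M2.
  apply: mulr_ge0 => //; apply: divr_ge0; last exact: sqr_ge0.
  by apply: mulr_ge0 => //; exact: sqr_ge0.
apply: (@le_trans _ _ `|(cutoff rho a - 1) * v2 a|); first exact: ler_piMr.
have [aB|Ba] := leP B `|a|.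
  by rewrite (test_supported2 tv aB) mulr0 normr0.
rewrite normrM; apply: ler_pM => //; last exact: test_bound2 tv a.
rewrite distrC ger0_norm ?subr_ge0 ?cutoff_le1//.
apply: (le_trans (cutoff_near1 _ _)); rewrite ler_pM2r ?invr_gt0 ?exprn_gt0//.
rewrite ler_wpM2l// -real_normK ?num_real// ler_sqr ?nnegrE//; exact: ltW.
Qed.

Lemma corrected_increment N rho L kappa M2 M3 M4 B v v2 v4 h a : 1 <= rho ->
  test_function L kappa M2 M3 M4 B v v2 v4 -> 0 <= B -> B <= N%:R / n%:R ->
  0 <= h -> S a ->
  `|T h (corrected N rho v v2) a - corrected N rho v v2 a - h * (c * v2 a)| <=
  h * (2 * (M3 * s) + 3 * B ^+ 2 / rho ^+ 2 * M2 + 132 * (M2 * mass N) / rho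
       + h * (2 * M4)).
Proof.
move=> r1 tv B0 BN h0 Sa; have r0 : 0 < rho by exact: lt_le_trans r1.
have [nv nv2] := test_function_nice tv.
have [npsi spsi] := corrected_nice N r0 tv.
case/andP: (c01) => c0 c1.
have bs : bounded_support (corrected N rho v v2).
  have [M hM] := spsi; exists (Num.max M B) => x; rewrite gt_max => /andP[Mx Bx].
  by rewrite /corrected/= -[cutoff _ _ * _]/((cutoff rho \* psi N v2) x) hM// addr0
    (test_supported tv)// ltW.
apply: (generator_increment (q := c \*o v2) genX) => //.
- exact: niceD.
- exact: niceZ.
- by move=> b Sb; exact: corrected_generator tv B0 BN Sb.
- move=> u b u0 uh Sb; rewrite semigroupZ//= -mulrBr normrM (ger0_norm c0).
  have [_ [[v3 d3 d4] _] _ _ _ b4 _ s2] := tv.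
  have := chain_lipschitz n0 tau1 genX (supported_bounded_support s2) nv2 u0
    (fun a => lap_bound0 n0 a d3 d4 b4) Sb.
  have M40 : 0 <= M4 by exact: le_trans (b4 0).
  move=> hl; apply: (le_trans (ler_piMl _ c1)) => //; apply: (le_trans hl).
  by rewrite ler_wpM2r// mulr_ge0.
Qed.

Lemma psi_weight N N' rho D a : 0 < rho -> rho * n%:R <= N'%:R -> S a ->
  `|cutoff rho a * psi N D a| <= size N N' D * weight rho a.
Proof.
move=> r0 rN [y _ ya]; rewrite -ya.
have [h|h] := leP rho `|y%:~R / n%:R|.
  by rewrite /weight/= cutoff_out// !mul0r mulr0 normr0.
rewrite normrM ger0_norm ?cutoff_ge0// /weight/= [leRHS]mulrCA.
rewrite ler_wpM2l ?cutoff_ge0// [leRHS]mulrC.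
have yN : (`|y| <= N')%N.
  rewrite -(ler_nat R) natr_absz intr_norm.
  apply: le_trans rN; rewrite -ler_pdivrMr//.
  by move: h; rewrite normrM normfV (gtr0_norm nR) => /ltW.
exact: corrector_bound.
Qed.

(** Telescoping over the corrected iterates. The correctors enter at the two
ends, and through their increments from one step to the next, which are
correctors of the increments of [v'']; these are of the order of the time step,
so that the sum over the steps stays bounded as the step tends to [0]. *)
Lemma chain_walk L kappa M2 M3 M4 B0 v v2 v4 (h r rho A a : R) k N N' :
  test_function L kappa M2 M3 M4 B0 v v2 v4 ->
  0 <= h -> 0 <= r -> r ^+ 2 / 2 = h * c -> 0 <= B0 ->
  B0 + k%:R * r <= N%:R / n%:R -> 1 <= rho -> rho * n%:R <= N'%:R ->
  S a -> `|a| <= A ->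
  `|T (k%:R * h) v a - iter k (walk_step r) v a| <=
   k%:R * h * (2 * (M3 * s) + 3 * (B0 + k%:R * r) ^+ 2 / rho ^+ 2 * M2
     + 132 * (M2 * mass N) / rho + h * (2 * M4) + 2 * r * M3) +
   (size N N' v2 + size N N' (iter k (walk_step r) v2) +
    \sum_(j < k) size N N'
      (fun x => iter j (walk_step r) v2 x - iter j.+1 (walk_step r) v2 x)) *
   (1 + A ^+ 2 + 662 * (k%:R * h)).
Proof.
move=> tv h0 r0 rh B00 BN r1 rN Sa aA; have rho0 : 0 < rho by exact: lt_le_trans r1.
case/andP: (c01) => c0 c1.
pose vj j := iter j (walk_step r) v; pose vj2 j := iter j (walk_step r) v2.
pose vj4 j := iter j (walk_step r) v4.
set B := B0 + k%:R * r.
have B0' : 0 <= B by rewrite addr_ge0// mulr_ge0.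
have tj j : (j <= k)%N -> test_function L kappa M2 M3 M4 B (vj j) (vj2 j) (vj4 j).
  move=> jk; have [t1 t2 t3 t4 t5 t6 t7 t8] := walk_iter_test j r0 tv.
  have BB : B0 + j%:R * r <= B by rewrite lerD2l ler_wpM2r// ler_nat.
  by split => //; apply: supportedS BB _.
have tj' j := walk_iter_test j r0 tv.
have M30 : 0 <= M3.
  by have := test_lipschitz2 tv 1 0; rewrite subr0 normr1 mulr1; exact: le_trans.
pose G j := corrected N rho (vj j) (vj2 j).
pose W := weight rho.
set eps := 2 * (M3 * s) + _ + _ + _ + _.
pose z j := size N N' (fun x => vj2 j x - vj2 j.+1 x).
have kh0 : 0 <= k%:R * h by rewrite mulr_ge0.
have nW : nice W by exact: weight_nice.
have sz0 D : 0 <= size N N' D by exact: corrector_size_ge0.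
have wA u : 0 <= u -> u <= k%:R * h -> T u W a <= 1 + A ^+ 2 + 662 * (k%:R * h).
  move=> u0 uh; apply: (le_trans (chain_weight n0 tau1 genX r1 u0 Sa)).
  have a2 : a ^+ 2 <= A ^+ 2.
    by rewrite -real_normK ?num_real// ler_sqr ?nnegrE// (le_trans _ aA).
  apply: lerD; [by rewrite lerD2l|apply: ler_wpM2l uh; exact: ler0n].
have nG j : nice (G j).
  have [nv _] := test_function_nice (tj' j); apply: niceD => //.
  by have [] := corrected_nice N rho0 (tj' j).
have main := @telescope _ _ X G W h (h * eps) (1 + A ^+ 2 + 662 * (k%:R * h)) z k a
  h0 Sa nG nW (fun j => sz0 _) _ wA.
have {main} : `|T (k%:R * h) (G 0%N) a - G k a| <=
    k%:R * (h * eps) + (\sum_(j < k) z j) * (1 + A ^+ 2 + 662 * (k%:R * h)).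
  apply: main => j b jk Sb.
  have inc := corrected_increment r1 (tj j (ltnW jk)) B0' BN h0 Sb.
  have := walk_step_increment b r0 (tj j (ltnW jk)).
  rewrite rh -mulrA -[walk_step r (vj j) b]/(vj j.+1 b) => w1.
  have -> : T h (G j) b - G j.+1 b =
    (T h (G j) b - G j b - h * (c * vj2 j b)) -
    (vj j.+1 b - vj j b - h * (c * vj2 j b)) +
    cutoff rho b * (psi N (vj2 j) b - psi N (vj2 j.+1) b).
    by rewrite /G /corrected/=; ring.
  rewrite correctorB.
  apply: (le_trans (ler_normD _ _)); apply: lerD; last exact: psi_weight.
  apply: (le_trans (ler_normB _ _)).
  rewrite /eps mulrDr; apply: lerD => //.
  apply: (le_trans w1).
  have -> : h * (2 * r * M3) = 2 * h * r * M3 by ring.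
  apply: ler_wpM2r => //; rewrite exprSr; apply: ler_wpM2r => //.
  have -> : r ^+ 2 = 2 * (h * c) by rewrite -rh; field.
  by rewrite ler_wpM2l// ler_piMr.
rewrite mulrA => main.
have [nv _] := test_function_nice tv.
have [np _] := corrected_nice N rho0 tv.
have p0 : `|T (k%:R * h) (cutoff rho \* psi N v2) a| <=
    size N N' v2 * (1 + A ^+ 2 + 662 * (k%:R * h)).
  apply: (@le_trans _ _ (T (k%:R * h) (size N N' v2 \*o W) a)).
    apply: semigroup_norm_le => //; first exact: niceZ.
    by move=> b Sb; exact: psi_weight.
  by rewrite semigroupZ// ler_wpM2l// wA.
have pk : `|cutoff rho a * psi N (vj2 k) a| <=
    size N N' (vj2 k) * (1 + A ^+ 2 + 662 * (k%:R * h)).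
  apply: (le_trans (psi_weight N (vj2 k) rho0 rN Sa)); rewrite ler_wpM2l//.
  by have := wA 0 (lexx 0) kh0; rewrite semigroup0.
have E : T (k%:R * h) v a - vj k a = (T (k%:R * h) (G 0%N) a - G k a)
   - T (k%:R * h) (cutoff rho \* psi N v2) a + cutoff rho a * psi N (vj2 k) a.
  by rewrite /G semigroupD// /corrected/=; ring.
rewrite E; apply: (le_trans (ler_normD _ _)).
have := lerD (le_trans (ler_normB _ _) (lerD main p0)) pk.
move=> /le_trans; apply; rewrite le_eqVlt; apply/orP; left; apply/eqP.
rewrite -/(vj2 k) /z; ring.
Qed.

End chain_walk.

(** * Moments of the traps *)

Section environment.
Context {R : realType} (alpha : R) (d : measure_display) (Omega : measurableType d).
Context (P : probability Omega R) (tau : int -> {RV P >-> R}).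
Hypothesis alpha3 : 3 <= alpha.
Hypothesis ipar : iid_pareto alpha tau.

Let measurable_ge (x : int) (u : R) : measurable [set w | u <= tau x w].
Proof.
rewrite (_ : [set _ | _] = setT `&` tau x @^-1` `[u, +oo[); last first.
  by apply/seteqP; split => w /=; rewrite in_itv/= andbT// => -[].
exact: measurable_funP.
Qed.

Lemma same_tail (x : int) (u : R) :
  P [set w | u <= tau x w] = P [set w | u <= tau 0 w].
Proof.
have [_ id _] := ipar.
have := id x 0 [set v | u <= v]; apply.
by rewrite (_ : [set _ | _] = [set` `[u, +oo[])//; apply/seteqP; split => w /=;
  rewrite in_itv/= andbT.
Qed.

Lemma trap_ge1_prob (x : int) : P [set w | 1 <= tau x w] = 1%E.
Proof.
have [_ _ tl] := ipar.
apply/eqP; rewrite eq_le probability_le1//=.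
apply/lee_addgt0Pr => e e0.
have [e1|e1] := leP 1 e.
  by apply: (@le_trans _ _ e%:E); rewrite ?lee_fin// leeDr.
pose u : R := (1 - e) `^ (- alpha^-1).
have a0 : 0 < alpha by apply: lt_le_trans alpha3.
have ae : 0 < 1 - e by rewrite subr_gt0.
have u1 : 1 < u.
  rewrite /u powRN invf_gt1 ?powR_gt0//.
  rewrite -[ltRHS](_ : 1 `^ alpha^-1 = 1); last by rewrite powR1.
  by apply: gt0_ltr_powR; rewrite ?nnegrE ?invr_gt0//; [exact: ltW|rewrite ltrBlDr ltrDl].
have ut : u `^ (- alpha) = 1 - e.
  by rewrite /u -powRrM mulrNN mulVf ?gt_eqF// powRr1// ltW.
apply: (@le_trans _ _ (P [set w | (u <= tau x w)%R] + e%:E)%E).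
  by rewrite same_tail tl// ut -EFinD subrK.
apply: leeD2r; apply: le_measure; rewrite ?inE//.
by move=> w /=; apply: le_trans; exact: ltW.
Qed.

Let tail_pow2 (k : nat) : (P [set w | (2 ^+ k <= tau 0 w)%R] <= ((2^-1 ^+ k) ^+ 3)%:E)%E.
Proof.
have [_ _ tl] := ipar.
case: k => [|k]; first by rewrite !expr0 expr1n probability_le1.
rewrite tl; last by rewrite exprn_egt1// ltr1n.
rewrite lee_fin powRN exprVn [leRHS]exprVn lef_pV2 ?posrE ?exprn_gt0 ?powR_gt0 ?exprn_gt0//.
rewrite -powR_mulrn ?exprn_ge0//.
by apply: ler_powR => //; rewrite exprn_ege1// ler1n.
Qed.

(** Dyadic decomposition: [tau ^ 2] is at most [4 ^ (k + 1)] on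
[2 ^ k <= tau < 2 ^ (k + 1)], an event of probability at most [8 ^ - k]. *)
Lemma trap_second_moment0 : (\int[P]_w ((tau 0 w) ^+ 2)%:E <= 8%:E)%E.
Proof.
pose A k := [set w | (2 ^+ k <= tau 0 w)%R].
pose F k w := ((4 ^+ k.+1)%:E * (\1_(A k) w)%:E)%E : \bar R.
have F0 k w : (0 <= F k w)%E by apply: mule_ge0; rewrite lee_fin ?exprn_ge0// indicE ler0n.
have mF k : measurable_fun setT (F k).
  by apply: measurable_funeM; apply/measurable_EFinP; exact/measurable_indic/measurable_ge.
apply: (@le_trans _ _ (\int[P]_w (\sum_(k <oo) F k w))%E).
  apply: ae_ge0_le_integral => //.
  - by move=> w _; rewrite lee_fin sqr_ge0.
  - by apply/measurable_EFinP; apply: measurable_funX; exact: measurable_funP.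
  - by move=> w _; apply: nneseries_ge0.
  - exact: ge0_emeasurable_sum.
  exists (~` [set w | 1 <= tau 0 w]); split; first exact: measurableC.
    by have := probability_setC P (measurable_ge 0 1); rewrite trap_ge1_prob subee.
  move=> w /= h t1; apply: h => _.
  have [k kl ku] : exists2 k : nat, 2 ^+ k <= tau 0 w & tau 0 w < 2 ^+ k.+1.
    have ex : exists m : nat, (tau 0 w < 2 ^+ m.+1).
      exists (Num.truncn (tau 0 w)); apply: (lt_le_trans (truncnS_gt _)).
      by rewrite -natrX ler_nat; exact/ltnW/ltn_expl.
    case: (ex_minnP ex) => k ku kmin; exists k => //.
    case: k ku kmin => [|k] _ kmin; first by rewrite expr0.
    by rewrite leNgt; apply/negP => /kmin; rewrite ltnn.
  apply: (@le_trans _ _ (F k w)).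
    rewrite /F indicE mem_set//= mule1 lee_fin.
    have -> : 4 ^+ k.+1 = (2 ^+ k.+1) ^+ 2 :> R by rewrite exprAC; congr (_ ^+ _); rewrite -natrX.
    have t0 : 0 <= tau 0 w := le_trans ler01 t1.
    by rewrite ler_sqr ?nnegrE ?exprn_ge0//; exact: ltW.
  apply: (@le_trans _ _ (\sum_(0 <= i < k.+1) F i w)%E).
    by rewrite big_nat_recr//= leeDr// sume_ge0// => i _; exact: F0.
  by apply: nneseries_lim_ge => i _ _; exact: F0.
rewrite integral_nneseries//.
apply: lime_le.
  by apply: is_cvg_nneseries => n _ _; apply: integral_ge0.
apply: nearW => n.
apply: (@le_trans _ _ (\sum_(0 <= k < n) (4 * 2^-1 ^+ k)%:E)%E).
  apply: lee_sum => k _.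
  rewrite ge0_integralZl//; last first.
  by apply/measurable_EFinP; exact/measurable_indic/measurable_ge.
  rewrite integral_indic ?setIT//; last exact: measurable_ge.
  apply: (le_trans (lee_wpmul2l _ (tail_pow2 k))); first by rewrite lee_fin exprn_ge0.
  rewrite -EFinM lee_fin exprS (_ : 4 ^+ k = (2 ^+ k) ^+ 2 :> R); last by rewrite exprAC; congr (_ ^+ _); rewrite -natrX.
  rewrite le_eqVlt; apply/orP; left; apply/eqP; rewrite exprVn; field.
  by rewrite lt0r_neq0// exprn_gt0.
rewrite sumEFin lee_fin -mulr_sumr.
have -> : \sum_(0 <= k < n) 2^-1 ^+ k = 2 - 2 * 2^-1 ^+ n :> R.
  elim: n => [|n ih]; first by rewrite big_geq// expr0; ring.
  by rewrite big_nat_recr//= ih exprS; field.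
have : 0 <= 2^-1 ^+ n :> R by rewrite exprn_ge0.
lra.
Qed.

End environment.

Section mean.
Context {R : realType} (d : measure_display) (Omega : measurableType d).
Context (P : probability Omega R).

Definition mean_le (F : Omega -> R) (k : R) : Prop :=
  [/\ measurable_fun setT F, forall w, 0 <= F w & (\int[P]_w (F w)%:E <= k%:E)%E].

Lemma integral_prob_cst (k : R) : (\int[P]_w k%:E = k%:E)%E.
Proof.
transitivity (k%:E * P setT)%E; first exact: (integral_cst P measurableT k%:E).
by rewrite probability_setT mule1.
Qed.

Lemma mean_le_cst k : 0 <= k -> mean_le (cst k) k.
Proof.
move=> k0; split => //.
by rewrite integral_prob_cst.
Qed.

Lemma mean_leD F G k l : mean_le F k -> mean_le G l ->
  mean_le (fun w => F w + G w) (k + l).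
Proof.
move=> [mF F0 iF] [mG G0 iG]; split; first exact: measurable_funD.
  by move=> w; exact: addr_ge0.
under eq_integral do rewrite EFinD.
rewrite ge0_integralD//; first by rewrite EFinD leeD.
- by move=> w _; rewrite lee_fin.
- exact/measurable_EFinP.
- by move=> w _; rewrite lee_fin.
- exact/measurable_EFinP.
Qed.

Lemma mean_leZ a F k : 0 <= a -> mean_le F k -> mean_le (fun w => a * F w) (a * k).
Proof.
move=> a0 [mF F0 iF]; split; first exact: measurable_funM.
  by move=> w; exact: mulr_ge0.
under eq_integral do rewrite EFinM.
rewrite ge0_integralZl//; first by rewrite EFinM lee_wpmul2l.
- exact/measurable_EFinP.
- by move=> w _; rewrite lee_fin.
Qed.

Lemma mean_le_sum N (F : nat -> Omega -> R) (k : nat -> R) :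
  (forall i, mean_le (F i) (k i)) ->
  mean_le (fun w => \sum_(i < N) F i w) (\sum_(i < N) k i).
Proof.
move=> h; elim: N => [|N ih].
  rewrite big_ord0 (_ : (fun _ => _) = cst 0); first exact: mean_le_cst.
  by apply/funext => w; rewrite big_ord0.
rewrite big_ord_recr/=.
rewrite (_ : (fun _ => _) = fun w => \sum_(i < N) F i w + F N w).
  exact: mean_leD.
by apply/funext => w; rewrite big_ord_recr.
Qed.

Lemma mean_leW F k l : k <= l -> mean_le F k -> mean_le F l.
Proof. by move=> kl [mF F0 iF]; split => //; rewrite (le_trans iF)// lee_fin. Qed.

Lemma mean_le_integrable F k : mean_le F k -> P.-integrable setT (EFin \o F).
Proof.
move=> [mF F0 iF]; apply/integrableP; split; first exact/measurable_EFinP.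
rewrite (eq_integral (EFin \o F)).
  by apply: (le_lt_trans iF); rewrite ltry.
by move=> w _ /=; rewrite ger0_norm.
Qed.

(** The inequality of Cauchy and Schwarz, obtained by averaging
[2 |S| <= a + S ^ 2 / a]. *)
Lemma mean_le_norm (S : Omega -> R) (a : R) : 0 < a ->
  mean_le (fun w => S w ^+ 2) (a ^+ 2) -> measurable_fun setT S ->
  mean_le (fun w => `|S w|) a.
Proof.
move=> a0 hS mS; split => //; first exact: measurableT_comp.
have : mean_le (fun w => 2^-1 * (a + a^-1 * S w ^+ 2)) (2^-1 * (a + a^-1 * a ^+ 2)).
  apply: mean_leZ; rewrite ?invr_ge0//.
  by apply: mean_leD; [exact: mean_le_cst (ltW a0)|apply: mean_leZ; rewrite ?invr_ge0 ?ltW].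
rewrite (_ : 2^-1 * _ = a); last by field; exact: lt0r_neq0.
move=> [_ _]; apply: le_trans; apply: le_integral_any => w; rewrite lee_fin.
rewrite -[S w ^+ 2]real_normK ?num_real//; set b := `|S w|.
rewrite -subr_ge0.
have -> : 2^-1 * (a + a^-1 * b ^+ 2) - b = (a - b) ^+ 2 / (2 * a).
  by field; exact: lt0r_neq0.
by rewrite divr_ge0 ?sqr_ge0// mulr_ge0// ltW.
Qed.

End mean.

Section noise.
Context {R : realType} (alpha : R) (d : measure_display) (Omega : measurableType d).
Context (P : probability Omega R) (tau : int -> {RV P >-> R}).
Hypothesis alpha3 : 3 <= alpha.
Hypothesis ipar : iid_pareto alpha tau.
Local Notation c := (fine 'E_P[tau 0])^-1.
Local Notation f := (fun u : R => c * u - 1).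

Let mtau x : measurable_fun setT (tau x). Proof. exact: measurable_funP. Qed.

Let mc : measurable_fun setT f.
Proof. by apply: measurable_funB => //; apply: measurable_funM. Qed.

Lemma same_integral (g : R -> R) x : measurable_fun setT g ->
  P.-integrable setT (EFin \o (g \o tau 0)) ->
  P.-integrable setT (EFin \o (g \o tau x)) ->
  (\int[P]_w (g (tau x w))%:E = \int[P]_w (g (tau 0 w))%:E)%E.
Proof.
move=> mg i0 ix; have [_ id _] := ipar.
have mg' : measurable_fun setT (EFin \o g) by exact/measurable_EFinP.
rewrite -(@integral_distribution _ _ _ _ _ P (tau x) (EFin \o g) mg' ix).
rewrite -(@integral_distribution _ _ _ _ _ P (tau 0) (EFin \o g) mg' i0).
by apply: eq_measure_integral => A mA _; exact: id.
Qed.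

Lemma trap_second_moment x : mean_le P (fun w => tau x w ^+ 2) 8.
Proof.
split; [exact: measurable_funX|by move=> w; exact: sqr_ge0|].
have [_ id _] := ipar.
pose g (u : R) : \bar R := (u ^+ 2)%:E.
have mg' : measurable_fun setT g by apply/measurable_EFinP; exact: exprn_measurable.
have g0 y : (0 <= g y)%E by rewrite lee_fin sqr_ge0.
have e y := @ge0_integral_distribution _ _ _ _ _ P (tau y) _ mg' g0.
rewrite -[leLHS]/(\int[P]_w (g \o tau x) w)%E -e.
rewrite (@eq_measure_integral _ _ _ _ (distribution P (tau 0))).
  by rewrite e; exact: trap_second_moment0 alpha3 ipar.
by move=> A mA _; exact: id.
Qed.

Lemma trap_integrable x : P.-integrable setT (EFin \o tau x).
Proof.
have h := mean_leD (mean_le_cst P ler01) (trap_second_moment x).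
apply: le_integrable (mean_le_integrable h) => //.
  exact/measurable_EFinP.
move=> w _; rewrite lee_fin /=.
set t := tau x w; rewrite [leRHS]ger0_norm ?addr_ge0 ?sqr_ge0//.
rewrite -(real_normK (num_real t)); have := sqr_ge0 (`|t| - 1).
rewrite !expr2; have := normr_ge0 t; set b := `|t|; nra.
Qed.

Lemma trap_mean : (\int[P]_w (tau 0 w)%:E = (fine 'E_P[tau 0])%:E)%E.
Proof.
rewrite unlock fineK//; exact: integrable_fin_num (trap_integrable 0).
Qed.

Lemma trap_mean_ge1 : 1 <= fine 'E_P[tau 0].
Proof.
rewrite -lee_fin -trap_mean.
have mA : measurable [set w | 1 <= tau 0 w].
  rewrite (_ : [set _ | _] = setT `&` tau 0 @^-1` [set` `[1, +oo[]); last first.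
    by apply/seteqP; split => w /=; rewrite in_itv/= andbT// => -[].
  exact: mtau.
rewrite (_ : (\int[P]_w _ = \int[P]_w (Num.max 1 (tau 0 w))%:E)%E).
  rewrite -[leLHS](integral_prob_cst P 1).
  by apply: le_integral_any => w; rewrite lee_fin le_max lexx.
apply: ae_eq_integral => //.
- exact/measurable_EFinP.
- by apply/measurable_EFinP; apply: measurable_maxr.
exists (~` [set w | 1 <= tau 0 w]); split; first exact: measurableC.
  have := probability_setC P mA.
  by rewrite (trap_ge1_prob alpha3 ipar) subee.
by move=> w /= h t1; apply: h => _; rewrite max_r.
Qed.

Lemma noise_mean0 x : (\int[P]_w (f (tau x w))%:E = 0)%E.
Proof.
have ci : P.-integrable setT (EFin \o (fun w => c * tau x w)).
  exact: (integrableZl measurableT c (trap_integrable x)).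
have i1 : P.-integrable setT (EFin \o (fun _ : Omega => 1 : R)).
  exact: mean_le_integrable (mean_le_cst P ler01).
under eq_integral do rewrite EFinB.
rewrite (integralB_EFin measurableT ci i1).
under eq_integral do rewrite EFinM.
rewrite integralZl//; last exact: trap_integrable.
have -> : (\int[P]_w (tau x w)%:E = \int[P]_w (tau 0 w)%:E)%E.
  exact: (@same_integral idfun x (@measurable_id _ _ _) (trap_integrable 0) (trap_integrable x)).
rewrite trap_mean -EFinM mulVf; last by rewrite lt0r_neq0// (lt_le_trans ltr01 trap_mean_ge1).
by rewrite integral_prob_cst subee.
Qed.

Lemma noise_integrable x : P.-integrable setT (fun w => (f (tau x w))%:E).
Proof.
have i1 : P.-integrable setT (EFin \o (fun _ : Omega => 1 : R)).
  exact: mean_le_integrable (mean_le_cst P ler01).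
exact: (integrableB measurableT (integrableZl measurableT c (trap_integrable x)) i1).
Qed.

Lemma noise_second_moment x : mean_le P (fun w => f (tau x w) ^+ 2) 18.
Proof.
split.
- by apply: measurable_funX; exact: (measurableT_comp mc).
- by move=> w; exact: sqr_ge0.
have h := mean_leD (mean_leZ (ler0n R 2) (trap_second_moment x)) (mean_le_cst P (ler0n R 2)).
case: h => _ _; rewrite (_ : 2 * 8 + 2 = 18); last by rewrite -natrM -natrD.
apply: le_trans; apply: le_integral_any => w; rewrite lee_fin.
have m1 := trap_mean_ge1.
have c0 : 0 <= c by rewrite invr_ge0 (le_trans ler01).
have c1 : c <= 1 by rewrite invf_le1// (lt_le_trans ltr01).
set t := tau x w; have : (c * t) ^+ 2 <= t ^+ 2.
  rewrite exprMn ler_piMl ?sqr_ge0// exprn_ile1//.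
have : 0 <= (c * t + 1) ^+ 2 by exact: sqr_ge0.
rewrite !expr2 => h1 h2; set u := c * t in h1 h2 *; lra.
Qed.

(** Independence identifies the joint law of two traps with the product of their
laws, where the theorem of Fubini applies. *)
Lemma noise_orthogonal x y : x != y ->
  (\int[P]_w (f (tau x w) * f (tau y w))%:E = 0)%E.
Proof.
move=> xy.
have [ind id _] := ipar.
pose Zf (w : Omega) := (tau x w, tau y w).
have mZ : measurable_fun setT Zf by exact: measurable_fun_pair.
pose Zm := isMeasurableFun.Build _ _ _ _ _ mZ.
pose Z : {mfun Omega >-> (R * R)%type} := MeasurableFun.Pack (MeasurableFun.Class Zm).
have joint : forall A B, measurable A -> measurable B ->
    distribution P Z (A `*` B) = (distribution P (tau x) A * distribution P (tau y) B)%E.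
  move=> A B mA mB.
  have := ind [:: x; y] (fun i => if i == x then A else B) _ _.
  rewrite !big_cons big_nil mule1 eqxx eq_sym (negbTE xy) => h.
  rewrite /distribution /pushforward/=.
  rewrite (_ : _ @^-1` _ = [set w | forall i, i \in [:: x; y] ->
      (if i == x then A else B) (tau i w)]).
    apply: h; first by rewrite /= inE xy.
    by move=> i; case: ifP.
  apply/seteqP; split => w /=.
    by move=> [Ax By] i; rewrite !inE => /orP[/eqP->|/eqP->]; rewrite ?eqxx// eq_sym (negbTE xy).
  move=> h'; split.
    by have := h' x; rewrite inE eqxx/=; apply.
  by have := h' y; rewrite !inE eqxx orbT eq_sym (negbTE xy); apply.
have uniqJ := product_measure_unique joint.
have mff : measurable_fun setT (fun z : R * R => (f z.1 * f z.2)%:E).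
  apply/measurable_EFinP; apply: measurable_funM.
    exact: (measurableT_comp mc measurable_fst).
  exact: (measurableT_comp mc measurable_snd).
have iP : P.-integrable setT (fun w => (f (tau x w) * f (tau y w))%:E).
  have h := mean_leD (noise_second_moment x) (noise_second_moment y).
  apply: le_integrable (mean_le_integrable h) => //.
    exact: (measurableT_comp mff mZ).
  move=> w _; rewrite lee_fin.
  set a := f (tau x w); set b := f (tau y w).
  rewrite [leRHS]ger0_norm ?addr_ge0 ?sqr_ge0// normrM.
  rewrite -(real_normK (num_real a)) -(real_normK (num_real b)).
  have := sqr_ge0 (`|a| - `|b|); have := normr_ge0 a; have := normr_ge0 b.
  by move: `|a| `|b| => p q; rewrite !expr2; nra.
pose ff (z : R * R) : \bar R := (f z.1 * f z.2)%:E.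
have iJ : (distribution P Z).-integrable setT ff.
  exact: (integrable_pushforward mZ mff iP measurableT).
have eJ g : (\int[distribution P Z]_z g z =
    \int[(distribution P (tau x) \x distribution P (tau y))%E]_z g z)%E.
  by apply: eq_measure_integral => A mA _; exact/esym/uniqJ.
have iprod : (distribution P (tau x) \x distribution P (tau y))%E.-integrable setT ff.
  by apply/integrableP; split => //; rewrite -eJ; case/integrableP: iJ.
transitivity (\int[distribution P Z]_z ff z)%E.
  by rewrite (@integral_distribution _ _ _ _ _ P Z ff mff iP).
rewrite eJ -(integral12_prod_meas1 iprod).
apply: integral0_eq => u _; rewrite /fubini_F /ff/=.
have mf' : measurable_fun setT (EFin \o f) by exact/measurable_EFinP.
have iy : (distribution P (tau y)).-integrable setT (EFin \o f).
  exact: (integrable_pushforward (mtau y) mf' (noise_integrable y) measurableT).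
under eq_integral do rewrite EFinM.
rewrite integralZl//.
rewrite (@integral_distribution _ _ _ _ _ P (tau y) (EFin \o f) mf' (noise_integrable y)).
by rewrite noise_mean0 mule0.
Qed.

End noise.

Section mean_corrector.
Context {R : realType} (alpha : R) (d : measure_display) (Omega : measurableType d).
Context (P : probability Omega R) (tau : int -> {RV P >-> R}).
Hypothesis alpha3 : 3 <= alpha.
Hypothesis ipar : iid_pareto alpha tau.
Local Notation c := (fine 'E_P[tau 0])^-1.
Local Notation f := (fun u : R => c * u - 1).

Lemma measurable_noise x : measurable_fun setT (fun w => f (tau x w)).
Proof. by apply: measurable_funB => //; apply: measurable_funM. Qed.

Lemma noise_sum_square (iota_ : nat -> int) (e : nat -> R) (m : nat) (M : R) :
  injective iota_ -> (forall z, `|e z| <= M) ->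
  mean_le P (fun w => (\sum_(z < m) e z * f (tau (iota_ z) w)) ^+ 2)
    (18 * M ^+ 2 * m%:R).
Proof.
move=> inj eM; split.
- apply: measurable_funX; apply: measurable_sum => z.
  by apply: measurable_funM => //; exact: measurable_noise.
- by move=> w; exact: sqr_ge0.
have sq w : (((\sum_(z < m) e z * f (tau (iota_ z) w)) ^+ 2)%:E =
   \sum_(z < m) \sum_(y < m)
     (e z * e y)%:E * (f (tau (iota_ z) w) * f (tau (iota_ y) w))%:E)%E.
  rewrite expr2 mulr_suml -sumEFin; apply: eq_bigr => z _.
  rewrite mulr_sumr -sumEFin; apply: eq_bigr => y _.
  by rewrite -EFinM; congr EFin; ring.
have isq x : P.-integrable setT (fun w => (f (tau x w) * f (tau x w))%:E).
  exact: (mean_le_integrable (noise_second_moment alpha3 ipar x)).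
have iff x y : P.-integrable setT (fun w => (f (tau x w) * f (tau y w))%:E).
  have h := mean_leD (noise_second_moment alpha3 ipar x) (noise_second_moment alpha3 ipar y).
  apply: le_integrable (mean_le_integrable h) => //.
    apply/measurable_EFinP; apply: measurable_funM; exact: measurable_noise.
  move=> w _; rewrite lee_fin.
  set a := f (tau x w); set b := f (tau y w).
  rewrite [leRHS]ger0_norm ?addr_ge0 ?sqr_ge0// normrM.
  rewrite -(real_normK (num_real a)) -(real_normK (num_real b)).
  have := sqr_ge0 (`|a| - `|b|); have := normr_ge0 a; have := normr_ge0 b.
  by move: `|a| `|b| => p q; rewrite !expr2; nra.
under eq_integral do rewrite sq.
rewrite integral_sum//; last first.
  by move=> z; apply: integrable_sum => // y _; apply: integrableZl.
have -> : 18 * M ^+ 2 * m%:R = \sum_(z < m) 18 * M ^+ 2.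
  by rewrite sumr_const card_ord mulr_natr.
rewrite -sumEFin; apply: lee_sum => z _.
rewrite integral_sum//; last by move=> y; apply: integrableZl.
rewrite (bigD1 z)//= big1 ?adde0; last first.
  move=> y yz; rewrite integralZl// (noise_orthogonal alpha3 ipar) ?mule0//.
  by apply/eqP => /inj /val_inj yE; rewrite yE eqxx in yz.
rewrite integralZl//.
have [_ _ h] := noise_second_moment alpha3 ipar (iota_ z).
apply: (@le_trans _ _ ((e z * e z)%:E * 18%:E)%E).
  by apply: lee_wpmul2l => //; rewrite lee_fin -expr2 sqr_ge0.
rewrite -EFinM lee_fin mulrC; apply: ler_wpM2l; first exact: ler0n.
rewrite -expr2 -real_normK ?num_real// ler_sqr ?nnegrE//.
exact: le_trans (eM z).
Qed.

(** The terms are centred and pairwise orthogonal, so the second moment of the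
sum is at most [18 M ^ 2 (i + 1)], and [18 <= 5 ^ 2]. *)
Lemma mean_partial_sum (iota_ : nat -> int) (e : nat -> R) (N i : nat) (M : R) :
  0 < M -> injective iota_ -> (forall z, `|e z| <= M) ->
  mean_le P (fun w => `|partial_sum N (fun z => e z * f (tau (iota_ z) w)) i|)
    (5 * M * Num.sqrt i.+1%:R).
Proof.
move=> M0 inj eM.
have E w : partial_sum N (fun z => e z * f (tau (iota_ z) w)) i =
    \sum_(z < i.+1) ((z < N)%N%:R * e z) * f (tau (iota_ z) w).
  pose g z := ((z < N)%N%:R * e z) * f (tau (iota_ z) w).
  rewrite -[RHS]/(\sum_(z < i.+1) g z) /partial_sum.
  transitivity (\sum_(z < maxn N i.+1 | (z < N)%N && (z < i.+1)%N) g z).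
    rewrite (big_ord_widen_cond _ (fun z => (z <= i)%N)
       (fun z => e z * f (tau (iota_ z) w)) (leq_maxl N i.+1)).
    apply: eq_big => z; first by rewrite ltnS andbC.
    by move=> /andP[_ zN]; rewrite /g zN mul1r.
  rewrite (big_ord_widen _ g (leq_maxr N i.+1)).
  rewrite [LHS]big_mkcond [RHS]big_mkcond; apply: eq_bigr => z _.
  by rewrite /g; case: (ltnP z N); rewrite ?mul0r//=; case: ifP.
have eM' z : `|(z < N)%N%:R * e z| <= M.
  by rewrite normrM; case: (z < N)%N; rewrite ?normr1 ?mul1r// normr0 mul0r ltW.
have s0 : 0 < Num.sqrt i.+1%:R :> R by rewrite sqrtr_gt0 ltr0n.
rewrite (_ : (fun _ => _) =
  fun w => `|\sum_(z < i.+1) ((z < N)%N%:R * e z) * f (tau (iota_ z) w)|); last first.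
  by apply/funext => w; rewrite E.
apply: mean_le_norm.
- by rewrite !mulr_gt0.
- apply: mean_leW (noise_sum_square i.+1 inj eM').
  rewrite exprMn sqr_sqrtr ?ler0n// exprMn ler_wpM2r// ler_wpM2r ?sqr_ge0//.
  by rewrite -natrX ler_nat.
- apply: measurable_sum => z.
  by apply: measurable_funM => //; exact: measurable_noise.
Qed.

End mean_corrector.

Section scale_sum.
Context {R : realType} (n : nat).
Hypothesis n0 : (0 < n)%N.

(** Up to the factor [n sqrt n], a Riemann sum of [sqrt u / (1 + u ^ 2)], which
decays like [u ^ (-3/2)] and is dominated by the increments of
[- 1 / sqrt (n + i)]. *)
Lemma scale_sum_le N' : \sum_(i < N') Num.sqrt i.+1%:R /
  (1 + (i.+1%:R / n%:R) ^+ 2) <= 4 * n%:R * Num.sqrt n%:R :> R.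
Proof.
have nR : 0 < n%:R :> R by rewrite ltr0n.
have sn0 : 0 < Num.sqrt n%:R :> R by rewrite sqrtr_gt0.
pose q i : R := Num.sqrt (n + i)%:R.
have q0 i : 0 < q i by rewrite sqrtr_gt0 ltr0n addn_gt0 n0.
have qq i : q i ^+ 2 = n%:R + i%:R by rewrite sqr_sqrtr ?ler0n// natrD.
suff main i : Num.sqrt i.+1%:R / (1 + (i.+1%:R / n%:R) ^+ 2) <=
    4 * n%:R ^+ 2 * ((q i)^-1 - (q i.+1)^-1).
  have : \sum_(i < N') Num.sqrt i.+1%:R / (1 + (i.+1%:R / n%:R) ^+ 2) <=
      \sum_(i < N') 4 * n%:R ^+ 2 * ((q i)^-1 - (q i.+1)^-1).
    by apply: ler_sum => i _; exact: main.
  move=> /le_trans; apply; rewrite -mulr_sumr.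
  have -> : \sum_(i < N') ((q i)^-1 - (q i.+1)^-1) = (q 0%N)^-1 - (q N')^-1.
    elim: N' => [|N' ih]; first by rewrite big_ord0 subrr.
    by rewrite big_ord_recr/= ih; ring.
  apply: (@le_trans _ _ (4 * n%:R ^+ 2 * (q 0%N)^-1)).
    by rewrite ler_wpM2l ?mulr_ge0 ?sqr_ge0// gerBl invr_ge0 ltW.
  have key (x : R) : 0 < x -> n%:R = x ^+ 2 -> 4 * n%:R ^+ 2 * x^-1 = 4 * n%:R * x.
    by move=> x0 ->; field; exact: lt0r_neq0.
  by rewrite /q addn0 key// sqr_sqrtr// ltW.
set a := q i; set b := q i.+1; set s := Num.sqrt _.
have a0 : 0 < a by exact: q0.
have b0 : 0 < b by exact: q0.
have s0 : 0 < s by rewrite sqrtr_gt0 ltr0n.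
have ab : a <= b by rewrite ler_sqrt ?ltr0n ?ler_nat// addnS.
have b2 : b ^+ 2 = n%:R + i.+1%:R by exact: qq.
have ba : b ^+ 2 - a ^+ 2 = 1 by rewrite !qq -addn1 natrD; ring.
have s2 : s ^+ 2 = i.+1%:R by rewrite sqr_sqrtr ?ler0n.
have sb : s <= b by rewrite ler_sqrt ?ler_nat ?ltr0n// leq_addl.
clearbody a b s.
have step : (2 * b ^+ 3)^-1 <= a^-1 - b^-1.
  have h : a + b != 0 by rewrite lt0r_neq0 ?addr_gt0.
  have bma : b - a = (a + b)^-1.
    by apply: (mulIf h); rewrite mulVf// -[RHS]ba; ring.
  have -> : a^-1 - b^-1 = (a * b * (a + b))^-1.
    have -> : a^-1 - b^-1 = (b - a) * (a * b)^-1.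
      by field; apply/andP; split; exact: lt0r_neq0.
    by rewrite bma -invfM; congr (_^-1); ring.
  have p1 : 0 < 2 * b ^+ 3 by apply: mulr_gt0 => //; exact: exprn_gt0.
  have p2 : 0 < a * b * (a + b) by rewrite !mulr_gt0 ?addr_gt0.
  rewrite lef_pV2 ?posrE//.
  have -> : 2 * b ^+ 3 = b * b * (b + b) by ring.
  by apply: ler_pM; rewrite ?mulr_ge0 ?addr_ge0 ?lerD ?ler_pM// ltW.
apply: (@le_trans _ _ (4 * n%:R ^+ 2 * (2 * b ^+ 3)^-1)); last first.
  by rewrite ler_wpM2l// mulr_ge0 ?sqr_ge0.
rewrite -s2 in b2 *.
have d0 : 0 < 1 + (s ^+ 2 / n%:R) ^+ 2 by rewrite ltr_pwDl ?sqr_ge0.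
have b30 : 0 < 2 * b ^+ 3 by rewrite mulr_gt0 ?exprn_gt0.
rewrite ler_pdivrMr// mulrAC ler_pdivlMr//.
have -> : 4 * n%:R ^+ 2 * (1 + (s ^+ 2 / n%:R) ^+ 2) =
  2 * (2 * (n%:R ^+ 2 + (s ^+ 2) ^+ 2)) by field; exact: lt0r_neq0.
have -> : s * (2 * b ^+ 3) = 2 * (s * b ^+ 3) by ring.
rewrite ler_wpM2l//.
apply: (@le_trans _ _ ((b ^+ 2) ^+ 2)).
  have -> : (b ^+ 2) ^+ 2 = b * b ^+ 3 by ring.
  by rewrite ler_wpM2r// exprn_ge0 ?ltW.
rewrite b2; have := sqr_ge0 (n%:R - s ^+ 2).
set y := s ^+ 2; rewrite !expr2; lra.
Qed.

End scale_sum.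

Section mean_size.
Context {R : realType} (alpha : R) (d : measure_display) (Omega : measurableType d).
Context (P : probability Omega R) (tau : int -> {RV P >-> R}) (n : nat).
Hypothesis alpha3 : 3 <= alpha.
Hypothesis ipar : iid_pareto alpha tau.
Hypothesis n0 : (0 < n)%N.
Local Notation c := (fine 'E_P[tau 0])^-1.

(** The factor [1 / sqrt n] is the central limit scaling of the noise; this is
where the rate of convergence comes from. *)
Lemma mean_corrector_size N N' D M : 0 < M -> (forall x, `|D x| <= M) ->
  mean_le P (fun w => corrector_size c (fun x => tau x w) n N N' D)
    (40 * M / Num.sqrt n%:R).
Proof.
move=> M0 DM.
have nR : 0 < n%:R :> R by rewrite ltr0n.
have sn0 : 0 < Num.sqrt n%:R :> R by rewrite sqrtr_gt0.
have right_ i : mean_le P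
    (fun w => `|partial_sum N (noise_right c (fun x => tau x w) n D) i|)
    (5 * M * Num.sqrt i.+1%:R).
  have := @mean_partial_sum _ _ _ _ P tau alpha3 ipar Posz (fun z => D (z%:R / n%:R)) N i M
    M0 (fun x y => _) (fun z => DM _).
  rewrite (_ : (fun w => _) = (fun w => `|partial_sum N (noise_right c (fun x => tau x w) n D) i|)).
    by apply; move=> x y [].
  apply/funext => w; congr (`|partial_sum N _ i|); apply/funext => z.
  by rewrite /noise_right mulrC.
have left_ i : mean_le P
    (fun w => `|partial_sum N (noise_left c (fun x => tau x w) n D) i|)
    (5 * M * Num.sqrt i.+1%:R).
  have := @mean_partial_sum _ _ _ _ P tau alpha3 ipar (fun z => - z%:Z)
    (fun z => (z != 0%N)%:R * D (- (z%:R / n%:R))) N i M M0 _ _.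
  rewrite (_ : (fun w => _) = (fun w => `|partial_sum N (noise_left c (fun x => tau x w) n D) i|)).
    apply; first by move=> x y /oppr_inj[].
    by move=> z; case: (z != 0%N); rewrite ?mul1r ?mul0r// normr0 ltW.
  apply/funext => w; congr (`|partial_sum N _ i|); apply/funext => z.
  by rewrite /noise_left; ring.
pose k (i : nat) : R := (1 + (i.+1%:R / n%:R) ^+ 2)^-1 *
  (5 * M * Num.sqrt i.+1%:R + 5 * M * Num.sqrt i.+1%:R).
have k0 (i : nat) : 0 <= (1 + (i.+1%:R / n%:R) ^+ 2)^-1 :> R.
  by rewrite invr_ge0 addr_ge0 ?sqr_ge0.
have := mean_leZ (a := n%:R ^- 2) _ (@mean_le_sum _ _ _ P N' _ k
  (fun i => mean_leZ (k0 i) (mean_leD (right_ i) (left_ i)))).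
rewrite (_ : (fun w => _) = (fun w => corrector_size c (fun x => tau x w) n N N' D)); last first.
  apply/funext => w; rewrite /corrector_size; congr (_ * _).
  by apply: eq_bigr => i _; rewrite mulrC.
have n20 : 0 <= n%:R ^- 2 :> R by rewrite invr_ge0 exprn_ge0.
move=> /(_ n20); apply: mean_leW.
have -> : \sum_(i < N') k i = 10 * M * \sum_(i < N') Num.sqrt i.+1%:R /
  (1 + (i.+1%:R / n%:R) ^+ 2).
  rewrite mulr_sumr; apply: eq_bigr => i _; rewrite /k.
  set x := _^-1; set y := Num.sqrt _; ring.
have h := ler_wpM2l (_ : 0 <= 10 * M) (scale_sum_le n0 N' : _ <= _ :> R).
have {}h := ler_wpM2l n20 (h _); apply: (le_trans (h _)); first by rewrite mulr_ge0// ltW.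
have key (x : R) : 0 < x -> n%:R = x ^+ 2 ->
    n%:R ^- 2 * (10 * M * (4 * n%:R * x)) = 40 * M / x.
  by move=> x0 ->; field; exact: lt0r_neq0.
by rewrite key// sqr_sqrtr// ltW.
Qed.

Lemma mean_noise_mass N :
  mean_le P (fun w => noise_mass c (fun x => tau x w) n N) (20 * N%:R / n%:R).
Proof.
have nR : 0 < n%:R :> R by rewrite ltr0n.
have one x : mean_le P (fun w => `|c * tau x w - 1|) 5.
  apply: mean_le_norm => //; last exact: measurable_noise.
  apply: mean_leW (noise_second_moment alpha3 ipar x).
  by rewrite -natrX ler_nat.
have := mean_leZ (a := n%:R^-1) _ (@mean_le_sum _ _ _ P N _ (fun=> 5 + 5)
  (fun z => mean_leD (one z%:Z) (one (- z%:Z)))).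
have n10 : 0 <= n%:R^-1 :> R by rewrite invr_ge0.
move=> /(_ n10); apply: mean_leW.
rewrite sumr_const card_ord [leLHS]mulrC ler_wpM2r//.
by rewrite -[leLHS]mulr_natr ler_wpM2r// -natrD ler_nat.
Qed.

End mean_size.

(** * All deterministic errors together *)

Section pathwise.
Context {R : realType} (c : R) (tau : int -> R) (n : nat).
Context (X : markov_process [set: R]) (Xn : markov_process (lattice R n)).
Hypothesis n0 : (0 < n)%N.
Hypothesis c01 : 0 <= c <= 1.
Hypothesis tau1 : forall x, 1 <= tau x.
Hypothesis genX : has_generator X [set g | C2 g /\ bounded_support g]
    (fun g x => c * derive1n 2 g x).
Hypothesis genXn : is_trap_chain tau Xn.

Lemma expect_close (S : set R) (Y : markov_process S) (e t a : R) (f g : R -> R) :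
  0 <= t -> nice f -> nice g -> (forall y, `|f y - g y| <= e) ->
  `|semigroup Y t f a - semigroup Y t g a| <= e.
Proof.
move=> t0 nf ng fg.
have ng1 : nice (-1 \*o g) by exact: niceZ.
have -> : semigroup Y t f a - semigroup Y t g a = semigroup Y t (f \+ (-1 \*o g)) a.
  by rewrite semigroupD// semigroupZ// mulN1r.
rewrite -[leRHS](semigroup_cst Y a e t0); apply: semigroup_norm_le => //.
- exact: niceD.
- exact: nice_cst.
- by move=> y _ /=; rewrite mulN1r.
Qed.

(** The terms are, in this order: truncation of [f] and mollification, each paid
once for either process; the distance between [x] and the lattice point [a];
the diffusion against the walk; the walk against the chain. *)
Lemma pathwise_bound (L L' kappa M2 M3 M4 B0 e r1 h r rho A x a t : R) (k N N' : nat)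
    (f v v2 v4 : R -> R) :
  nice f -> (forall y, `|f y| <= L) ->
  0 <= L' -> 0 < kappa -> test_function L' kappa M2 M3 M4 B0 v v2 v4 ->
  0 < r1 -> (forall y, `|v y - f y * cutoff r1 y| <= e) ->
  0 <= h -> 0 <= r -> r ^+ 2 / 2 = h * c -> 0 <= B0 ->
  B0 + k%:R * r <= N%:R / n%:R -> 1 <= rho -> rho * n%:R <= N'%:R ->
  lattice R n a -> `|x| <= A -> `|a| <= A -> `|x - a| <= n%:R^-1 ->
  k%:R * h = t ->
  `|semigroup X t f x - semigroup Xn t f a| <=
  2 * (L * ((3 * A ^+ 2 + 60 * t) / r1 ^+ 2)) + 2 * e + L' * n%:R^-1 `^ kappa +
  t * (h * M4 + 2 * r * M3) +
  (t * (2 * (M3 * n%:R^-1) + 3 * (B0 + k%:R * r) ^+ 2 / rho ^+ 2 * M2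
     + 132 * (M2 * noise_mass c tau n N) / rho + h * (2 * M4) + 2 * r * M3) +
   (corrector_size c tau n N N' v2 +
    corrector_size c tau n N N' (iter k (walk_step r) v2) +
    \sum_(j < k) corrector_size c tau n N N'
      (fun x => iter j (walk_step r) v2 x - iter j.+1 (walk_step r) v2 x)) *
   (1 + A ^+ 2 + 662 * t)).
Proof.
move=> nf fL L'0 k0 tv r10 ve h0 r0 rh B00 BN rho1 rN Sa xA aA xa ht.
have t0 : 0 <= t by rewrite -ht mulr_ge0.
have L0 : 0 <= L by exact: le_trans (fL 0).
have [nv _] := test_function_nice tv.
have nfc : nice (f \* cutoff r1) by apply: niceM => //; exact: cutoff_nice.
have sqA y : `|y| <= A -> L * ((3 * y ^+ 2 + 60 * t) / r1 ^+ 2) <=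
    L * ((3 * A ^+ 2 + 60 * t) / r1 ^+ 2).
  move=> yA; rewrite ler_wpM2l// ler_pM2r ?invr_gt0 ?exprn_gt0// lerD2r.
  by rewrite ler_wpM2l// -real_normK ?num_real// ler_sqr ?nnegrE// (le_trans _ yA).
have tr1 := truncation_error nf fL r10 t0 (I : [set: R] x)
  (diffusion_cutoff c01 genX x r10 t0).
have tr2 := truncation_error nf fL r10 t0 Sa (chain_cutoff n0 tau1 genXn r10 t0 Sa).
have {}tr1 := le_trans tr1 (sqA x xA).
have {}tr2 := le_trans tr2 (sqA a aA).
have cl1 := expect_close X x t0 nv nfc ve.
have cl2 := expect_close Xn a t0 nv nfc ve.
have w1 := diffusion_walk c01 genX x k tv h0 r0 rh.
have w2 := chain_walk n0 c01 tau1 genXn tv h0 r0 rh B00 BN rho1 rN Sa aA.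
rewrite ht in w1 w2.
have vk : `|iter k (walk_step r) v x - iter k (walk_step r) v a| <=
    L' * n%:R^-1 `^ kappa.
  apply: (le_trans (test_holder (walk_iter_test k r0 tv) x a)).
  by rewrite ler_wpM2l//; apply: ge0_ler_powR; rewrite ?nnegrE ?invr_ge0//; exact: ltW.
move: tr1 tr2 cl1 cl2 w1 w2 vk.
set a1 := semigroup X t f x; set a2 := semigroup X t _ x; set a3 := semigroup X t v x.
set b1 := semigroup Xn t f a; set b2 := semigroup Xn t _ a; set b3 := semigroup Xn t v a.
set wx := iter k _ v x; set wa := iter k _ v a.
set q1 := L * _; set q2 := L' * _; set q3 := t * (h * _ + _).
set q4 := (t * (2 * _ + _ + _ + _ + _) + _).
rewrite !ler_norml.
move=> /andP[p1 p2] /andP[p3 p4] /andP[p5 p6] /andP[p7 p8] /andP[p9 p10]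
  /andP[p11 p12] /andP[p13 p14].
apply/andP; split; lra.
Qed.

End pathwise.

(** For increments below [1] the cutoff is Lipschitz with constant at most [1];
for larger ones its oscillation is at most [1] anyway. *)
Lemma holder_cutoff (R : realType) (L kappa r : R) (f : R -> R) :
  0 < kappa -> kappa <= 1 -> 0 <= L -> 6 <= r -> (forall y, `|f y| <= L) ->
  holder L kappa f -> holder (2 * L) kappa (f \* cutoff r).
Proof.
move=> k0 k1 L0 r6 fL hf x y; have r0 : 0 < r by apply: lt_le_trans r6.
have cut : `|cutoff r x - cutoff r y| <= `|x - y| `^ kappa.
  have [xy|xy] := leP `|x - y| 1; last first.
    apply: (@le_trans _ _ 1).
      have := cutoff_ge0 r x; have := cutoff_ge0 r y.
      have := cutoff_le1 r x; have := cutoff_le1 r y.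
      by move=> *; rewrite ler_norml; apply/andP; split; lra.
    rewrite -[leLHS](_ : 1 `^ kappa = 1); last by rewrite powR1.
    by apply: ge0_ler_powR; rewrite ?nnegrE//; exact: ltW.
  have [c1 [c2 [d1 _ _ b1 _]]] := cutoff_twice_derivable r.
  apply: (le_trans (lipschitz_deriv d1 b1 x y)).
  apply: (@le_trans _ _ `|x - y|).
    by rewrite ler_piMl// ler_pdivrMr ?mul1r gtr0_norm.
  have [->|xy0] := eqVneq `|x - y| 0; first exact: powR_ge0.
  by apply: ger1_powR => //; rewrite xy andbT lt_neqAle eq_sym xy0/=.
have -> : (f \* cutoff r) x - (f \* cutoff r) y =
  (f x - f y) * cutoff r x + f y * (cutoff r x - cutoff r y) by rewrite /=; ring.
have -> : 2 * L * `|x - y| `^ kappa = L * `|x - y| `^ kappa + L * `|x - y| `^ kappa.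
  by ring.
apply: (le_trans (ler_normD _ _)); apply: lerD; rewrite normrM.
  apply: le_trans (hf x y); rewrite (ger0_norm (cutoff_ge0 _ _)).
  by rewrite ler_piMr// cutoff_le1.
by apply: ler_pM.
Qed.

(** * Averaging over the environment *)

Section parameters.
Context {R : realType}.

Lemma truncnS_ge (x : R) : x <= (Num.truncn x).+1%:R.
Proof. exact/ltW/truncnS_gt. Qed.

(** The time step may be chosen as small as desired once the test function is
fixed, as its cost [3 h M4 + 4 r M3] tends to [0]. The supports of the iterates
grow with the number of steps, and the radius of the cutoff is chosen after
it. *)
Lemma small_time_step (t c q M3 M4 : R) : 0 < t -> 0 <= c <= 1 -> 0 < q ->
  0 <= M3 -> 0 <= M4 ->
  exists (k : nat) (h r : R), [/\ 0 < h, 0 <= r, r ^+ 2 / 2 = h * c, k%:R * h = t &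
    t * (3 * h * M4 + 4 * r * M3) <= q].
Proof.
move=> t0 /andP[c0 c1] q0 M30 M40.
pose Q := t * (3 * M4 + 8 * M3).
have Q0 : 0 <= Q by rewrite mulr_ge0 ?addr_ge0 ?mulr_ge0// ltW.
(* Both [h <= eta] and [r <= 2 eta] will hold, at a total cost [eta * Q <= q]. *)
pose eta := q / (q + Q).
have qQ : 0 < q + Q by rewrite ltr_pwDl.
have eta0 : 0 < eta by rewrite divr_gt0.
have eta1 : eta <= 1 by rewrite ler_pdivrMr// mul1r lerDl.
have etaQ : eta * Q <= q by rewrite /eta mulrAC ler_pdivrMr// ler_wpM2l ?lerDr ?ltW.
clearbody eta; pose k := (Num.truncn (t / eta ^+ 2)).+1.
have k0 : 0 < k%:R :> R by rewrite ltr0n.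
pose h := t / k%:R.
have h0 : 0 < h by rewrite divr_gt0.
have hh : h <= eta ^+ 2.
  by rewrite ler_pdivrMr// mulrC -ler_pdivrMr ?exprn_gt0// truncnS_ge.
exists k, h, (Num.sqrt (2 * (h * c))); split => //.
- rewrite sqr_sqrtr; last by rewrite !mulr_ge0// ltW.
  by field.
- by rewrite /h mulrC divfK// lt0r_neq0.
set r := Num.sqrt _.
have r0 : 0 <= r by exact: sqrtr_ge0.
have re : r <= 2 * eta.
  have e2 : 0 <= 2 * eta by rewrite mulr_ge0// ltW.
  rewrite -(@ler_sqr _ r (2 * eta)) ?nnegrE// sqr_sqrtr; last by rewrite !mulr_ge0// ltW.
  have : h * c <= eta ^+ 2 by rewrite (le_trans _ hh)// ler_piMr// ltW.
  have := sqr_ge0 eta; rewrite exprMn (_ : 2 ^+ 2 = 4); last by rewrite -natrX.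
  lra.
have he : h <= eta by rewrite (le_trans hh)// expr2 ler_piMr// ltW.
apply: le_trans etaQ; rewrite /Q [leRHS]mulrCA ler_wpM2l ?(ltW t0)//.
have -> : eta * (3 * M4 + 8 * M3) = 3 * eta * M4 + 4 * (2 * eta) * M3 by ring.
by apply: lerD; apply: ler_wpM2r => //; apply: ler_wpM2l.
Qed.

Lemma large_cutoff (t q B M2 m : R) : 0 <= t -> 0 < q -> 0 <= B -> 0 <= M2 -> 0 <= m ->
  exists2 rho : R, 1 <= rho &
    t * (3 * B ^+ 2 / rho ^+ 2 * M2) + t * (132 * M2 / rho) * m <= q.
Proof.
move=> t0 q0 B0 M20 m0.
have c132 : 0 <= 132 :> R by exact: ler0n.
pose Y := t * (3 * B ^+ 2 * M2) + t * (132 * M2) * m.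
have Y1 : 0 <= t * (3 * B ^+ 2 * M2).
  by apply: mulr_ge0 => //; apply: mulr_ge0 => //; apply: mulr_ge0 => //; exact: sqr_ge0.
have Y2 : 0 <= t * (132 * M2) * m.
  by apply: mulr_ge0 => //; apply: mulr_ge0 => //; exact: mulr_ge0.
have Y0 : 0 <= Y by exact: addr_ge0.
have r1 : 1 <= 1 + Y / q by rewrite lerDl divr_ge0// ltW.
exists (1 + Y / q) => //; set rho := 1 + Y / q in r1 *.
have rho0 : 0 < rho by exact: lt_le_trans r1.
apply: (@le_trans _ _ (Y / rho)).
  have -> : t * (132 * M2 / rho) * m = t * (132 * M2) * m / rho by ring.
  have -> : t * (3 * B ^+ 2 / rho ^+ 2 * M2) = t * (3 * B ^+ 2 * M2) / rho ^+ 2 by ring.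
  rewrite /Y [leRHS]mulrDl; apply: lerD => //; apply: ler_wpM2l => //.
  by rewrite lef_pV2 ?posrE ?exprn_gt0// expr2 ler_peMr// ltW.
rewrite ler_pdivrMr// /rho mulrDr mulr1 mulrCA divff ?mulr1 ?lt0r_neq0//.
by rewrite lerDr ltW.
Qed.

End parameters.

Section quantitative.
Context {R : realType} (alpha : R) (d : measure_display) (Omega : measurableType d).
Context (P : probability Omega R) (tau : int -> {RV P >-> R}).
Context (X : markov_process [set: R]) (n : nat) (Xn : Omega -> markov_process (lattice R n)).
Hypothesis alpha3 : 3 <= alpha.
Hypothesis ipar : iid_pareto alpha tau.
Hypothesis n0 : (0 < n)%N.
Local Notation c := (fine 'E_P[tau 0])^-1.
Hypothesis diffX : is_diffusion c X.
Hypothesis chainX : forall w, (forall x, 0 < tau x w) -> is_trap_chain (fun x => tau x w) (Xn w).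

Definition bad_environment : set Omega := \bigcup_x [set w | tau x w < 1].

Lemma bad_environment_null : measurable bad_environment /\ P bad_environment = 0%E.
Proof.
have mlt x : measurable [set w | tau x w < 1].
  rewrite (_ : [set _ | _] = setT `&` tau x @^-1` [set` `]-oo, 1[]); last first.
    by apply/seteqP; split => w /=; rewrite in_itv/= // => -[].
  exact: measurable_funP.
have p0 x : P [set w | tau x w < 1] = 0%E.
  have mge : measurable [set w | 1 <= tau x w].
    rewrite (_ : [set w | 1 <= tau x w] = ~` [set w | tau x w < 1]); first exact: measurableC.
    by apply/seteqP; split => w /=; rewrite leNgt => /negP.
  have := probability_setC P mge; rewrite (trap_ge1_prob alpha3 ipar) subee// => <-.
  congr (P _); apply/seteqP; split => w /=; rewrite ltNge => /negP//.
have E : bad_environment =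
    (\bigcup_(k : nat) [set w | tau (Posz k) w < 1]) `|`
    (\bigcup_(k : nat) [set w | tau (Negz k) w < 1]).
  apply/seteqP; split => w; first by move=> [[k|k] _ wk]; [left|right]; exists k.
  by move=> [] [k _ wk]; [exists (Posz k)|exists (Negz k)].
have mE : measurable bad_environment.
  by rewrite E; apply: measurableU; exact: bigcupT_measurable.
split => //; apply: measure_negligible => //; rewrite E.
have ng x : P.-negligible [set w | tau x w < 1].
  by exists [set w | tau x w < 1]; split.
by apply: negligibleU; apply: negligible_bigcup => k; exact: ng.
Qed.

Lemma mean_bad_environment k : 0 <= k -> mean_le P (fun w => k * \1_bad_environment w) 0.
Proof.
move=> k0; have [mB PB] := bad_environment_null; rewrite -[X in mean_le _ _ X](mulr0 k).
apply: mean_leZ => //; split.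
- exact: measurable_indic.
- by move=> w; rewrite indicE ler0n.
- have := integral_indic P measurableT mB; rewrite setIT => ->.
  by rewrite le_eqVlt; apply/orP; left; apply/eqP; exact: PB.
Qed.

Lemma expect_diff_bad (L t a b : R) (f : R -> R) w : 0 <= t -> nice f ->
  (forall y, `|f y| <= L) ->
  `|semigroup X t f a - semigroup (Xn w) t f b| <= 2 * L.
Proof.
move=> t0 nf fL.
have h (S : set R) (Y : markov_process S) u : `|semigroup Y t f u| <= L.
  rewrite -[leRHS](semigroup_cst Y u L t0); apply: semigroup_norm_le => //.
  exact: nice_cst.
by rewrite (le_trans (ler_normB _ _))// mulr_natl mulr2n lerD.
Qed.

(** The mollification scale [dl = n ^ (-1/11)] balances the error
[dl ^ kappa] of smoothing against the mean size [n ^ (-1/2) dl ^ (kappa - 4)] of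
the correctors of the increments of [v'']: since [n ^ (-1/2) = dl ^ (11/2)], the
latter is at most [dl ^ kappa]. The radii and the time step are then chosen such
that the remaining errors are at most [L dl ^ kappa] too. *)
Lemma sup_expect_mean (L kappa t K dl : R) (f : R -> R) : 0 < t -> 0 < K ->
  0 < L -> 0 < kappa -> kappa <= 1 ->
  (forall y, `|f y| <= L) -> holder L kappa f ->
  0 < dl -> dl <= 1 -> n%:R^-1 = dl ^+ 11 ->
  (\int[P]_w ereal_sup
     [set `| mp_expect X x t f -
             mp_expect (Xn w) ((Num.floor (n%:R * x))%:~R / n%:R) t f |
       | x in [set x : R | (`|x| <= K)%R] ]
   <= ((21 + 16 * t + (1 + (K + 1) ^+ 2 + 662 * t) * (320 + 1280 * t)) * L * dl `^ kappa)%:E)%E.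
Proof.
move=> t0 K0 L0 k0 k1 fL hf dl0 dl1 ndl.
pose A := K + 1; pose p := dl `^ kappa.
have p0 : 0 < p by exact: powR_gt0.
have Lp0 : 0 < L * p by exact: mulr_gt0.
have nR : 0 < n%:R :> R by rewrite ltr0n.
have A0 : 0 <= A by rewrite addr_ge0// ltW.
have m1 := trap_mean_ge1 alpha3 ipar.
have c01 : 0 <= c <= 1.
  by rewrite invr_ge0 (le_trans ler01 m1) invf_le1// (lt_le_trans ltr01).
have [_ genX] := diffX.
have nf : nice f.
  split; last by exists L.
  by apply: continuous_measurable_fun; exact: holder_continuous (ltW L0) k0 hf.
pose z := 3 * A ^+ 2 + 60 * t.
have z0 : 0 <= z.
  apply: addr_ge0; first by rewrite mulr_ge0 ?sqr_ge0.
  by apply: mulr_ge0; [exact: ler0n|exact: ltW].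
(* At least [6], so that cutting off [f] preserves its regularity, and large
   enough for [2 z / r1 ^ 2 <= p]. *)
pose r1 := 6 + 2 * z / p.
have r16 : 6 <= r1 by rewrite lerDl divr_ge0 ?mulr_ge0// ltW.
have r10 : 0 < r1 by exact: lt_le_trans r16.
have zr1 : 2 * (L * (z / r1 ^+ 2)) <= L * p.
  rewrite mulrCA ler_wpM2l ?(ltW L0)// mulrA ler_pdivrMr ?exprn_gt0//.
  apply: (@le_trans _ _ (p * r1)).
    have -> : p * r1 = 6 * p + 2 * z by rewrite /r1; field; exact: lt0r_neq0.
    by rewrite lerDr mulr_ge0// ltW.
  rewrite ler_wpM2l ?(ltW p0)// expr2 ler_peMr ?(ltW r10)//; apply: le_trans r16.
  by rewrite ler1n.
have hfc := holder_cutoff k0 k1 (ltW L0) r16 fL hf.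
have L20 : 0 <= 2 * L by rewrite mulr_ge0// ltW.
have sfc : supported r1 (f \* cutoff r1).
  by move=> y ry; rewrite /= cutoff_out ?mulr0.
have [v [v2 [v4 [tv ve]]]] := mollification L20 k0 dl0 hfc sfc.
rewrite -/p in tv ve.
set M2 := 2 * (2 * L) * p / dl ^+ 2 in tv.
set M3 := 4 * (2 * L) * p / dl ^+ 3 in tv.
set M4 := 8 * (2 * L) * p / dl ^+ 4 in tv.
set B0 := r1 + 4 * dl in tv.
have M20 : 0 < M2 by rewrite /M2 divr_gt0 ?exprn_gt0// !mulr_gt0.
have M30 : 0 < M3 by rewrite /M3 divr_gt0 ?exprn_gt0// !mulr_gt0.
have M40 : 0 < M4 by rewrite /M4 divr_gt0 ?exprn_gt0// !mulr_gt0.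
have B00 : 0 <= B0 by rewrite addr_ge0 ?mulr_ge0// ltW.
have [k [h [r [h0 r0 rh kh hstep]]]] := small_time_step t0 c01 Lp0 (ltW M30) (ltW M40).
pose B := B0 + k%:R * r.
have B0' : 0 <= B by rewrite addr_ge0// mulr_ge0.
pose N := (Num.truncn (n%:R * B)).+1.
have BN : B <= N%:R / n%:R by rewrite ler_pdivlMr// mulrC truncnS_ge.
have m0 : 0 <= 20 * N%:R / n%:R :> R by rewrite divr_ge0// mulr_ge0.
have [rho rho1 hrho] := large_cutoff (ltW t0) Lp0 B0' (ltW M20) m0.
have rho0 : 0 < rho by exact: lt_le_trans rho1.
pose N' := (Num.truncn (rho * n%:R)).+1.
have rN : rho * n%:R <= N'%:R by exact: truncnS_ge.
pose wt := 1 + A ^+ 2 + 662 * t.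
have wt0 : 0 <= wt.
  apply: addr_ge0; first by rewrite addr_ge0 ?sqr_ge0.
  by apply: mulr_ge0; [exact: ler0n|exact: ltW].
pose det := 2 * (L * (z / r1 ^+ 2)) + 2 * (4 * (2 * L) * p) + 2 * L * n%:R^-1 `^ kappa +
  t * (3 * h * M4 + 4 * r * M3) + 2 * t * M3 * n%:R^-1 +
  t * (3 * B ^+ 2 / rho ^+ 2 * M2).
pose tw w x := tau x w.
pose sz w D := corrector_size c (tw w) n N N' D.
pose dj j x := iter j (walk_step r) v2 x - iter j.+1 (walk_step r) v2 x.
pose Err w := det + t * (132 * M2 / rho) * noise_mass c (tw w) n N +
  wt * (sz w v2 + sz w (iter k (walk_step r) v2) + \sum_(j < k) sz w (dj j)).
have det0 : 0 <= det.
  have n10 : 0 <= n%:R^-1 :> R by rewrite invr_ge0.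
  do !apply: addr_ge0.
  - do 2 (apply: mulr_ge0 => //; rewrite ?(ltW L0)//).
    by rewrite divr_ge0 ?sqr_ge0.
  - by apply: mulr_ge0 => //; apply: mulr_ge0; [apply: mulr_ge0|exact: ltW].
  - by apply: mulr_ge0 => //; exact: powR_ge0.
  - apply: mulr_ge0; first exact: ltW.
    by apply: addr_ge0; apply: mulr_ge0; rewrite ?(ltW M30) ?(ltW M40)//;
      apply: mulr_ge0 => //; exact: ltW.
  - by apply: mulr_ge0 => //; apply: mulr_ge0; [apply: mulr_ge0 => //|]; exact: ltW.
  - apply: mulr_ge0; first exact: ltW.
    apply: mulr_ge0; last exact: ltW.
    by apply: divr_ge0; [apply: mulr_ge0 => //|]; exact: sqr_ge0.
have cr0 : 0 <= t * (132 * M2 / rho).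
  apply: mulr_ge0; first exact: ltW.
  by apply: divr_ge0; [apply: mulr_ge0; [exact: ler0n|exact: ltW]|exact: ltW].
have djb j x : `|dj j x| <= 2 * h * M4.
  have := walk_step_increment2 x r0 (walk_iter_test j r0 tv).
  rewrite -[walk_step r _ x]/(iter j.+1 (walk_step r) v2 x) distrC => /le_trans; apply.
  apply: ler_wpM2r; first exact: ltW.
  have -> : r ^+ 2 = 2 * (h * c) by rewrite -rh; field.
  rewrite ler_wpM2l// ler_piMr//; [exact: ltW|by case/andP: c01].
have hM : 0 < 2 * h * M4 by apply: mulr_gt0 => //; exact: mulr_gt0.
have bound w : (forall x, 1 <= tau x w) -> forall x, `|x| <= K ->
    `|semigroup X t f x -
      semigroup (Xn w) t f ((Num.floor (n%:R * x))%:~R / n%:R)| <= Err w.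
  move=> tw1 x xK; set a := _ / _.
  have Sa : lattice R n a by exists (Num.floor (n%:R * x)).
  have xa : `|x - a| <= n%:R^-1.
    have /andP[f1 f2] := floor_itv (n%:R * x).
    rewrite intrD in f2.
    have -> : x - a = (n%:R * x - (Num.floor (n%:R * x))%:~R) / n%:R.
      by rewrite /a; field; exact: lt0r_neq0.
    rewrite normrM normfV (gtr0_norm nR) ler_piMl ?invr_ge0//.
    by rewrite ger0_norm; lra.
  have aA : `|a| <= A.
    have -> : a = x - (x - a) by ring.
    rewrite (le_trans (ler_normB _ _))// /A lerD// (le_trans xa)//.
    by rewrite invf_le1// ler1n.
  have xA : `|x| <= A by rewrite (le_trans xK)// lerDl.
  have gn : is_trap_chain (tw w) (Xn w).
    by apply: chainX => y; exact: lt_le_trans (tw1 y).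
  have := @pathwise_bound _ c (tw w) n X (Xn w) n0 c01 tw1 genX gn L (2 * L) kappa
    M2 M3 M4 B0 (4 * (2 * L) * p) r1 h r rho A x a t k N N' f v v2 v4 nf fL L20 k0 tv
    r10 ve (ltW h0) r0 rh B00 BN rho1 rN Sa xA aA xa kh.
  move=> /le_trans; apply; rewrite le_eqVlt; apply/orP; left; apply/eqP.
  rewrite /Err /det /sz /dj /wt /z /B; ring.
have mErr : mean_le P Err
    (det + t * (132 * M2 / rho) * (20 * N%:R / n%:R) +
     wt * (40 * M2 / Num.sqrt n%:R + 40 * M2 / Num.sqrt n%:R +
       \sum_(j < k) 40 * (2 * h * M4) / Num.sqrt n%:R)).
  have tk := walk_iter_test k r0 tv.
  apply: mean_leD.
    apply: mean_leD; first exact: mean_le_cst.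
    by apply: mean_leZ => //; exact: (mean_noise_mass alpha3 ipar n0 N).
  apply: mean_leZ => //; apply: mean_leD.
    apply: mean_leD.
      exact: (mean_corrector_size alpha3 ipar n0 N N' M20 (test_bound2 tv)).
    exact: (mean_corrector_size alpha3 ipar n0 N N' M20 (test_bound2 tk)).
  apply: (@mean_le_sum _ _ _ P k (fun j w => sz w (dj j))
    (fun=> 40 * (2 * h * M4) / Num.sqrt n%:R)) => j.
  exact: (mean_corrector_size alpha3 ipar n0 N N' hM (djb j)).
have [_ _ mean] := mean_leD mErr (mean_bad_environment L20).
apply: (@le_trans _ _ (\int[P]_w (Err w + 2 * L * \1_bad_environment w)%:E)%E).
  apply: le_integral_any => w; apply: ge_ereal_sup => _ [x xK <-].
  rewrite !expect_semigroup ?(ltW t0)// -EFinB lee_fin.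
  have [good|bad] := pselect (forall y, 1 <= tau y w).
    apply: (le_trans (bound w good x xK)); rewrite lerDl.
    by apply: mulr_ge0.
  have wb : bad_environment w.
    apply: contrapT => nb; apply: bad => y; rewrite leNgt; apply/negP => ly.
    by apply: nb; exists y.
  rewrite indicE mem_set// mulr1.
  apply: (le_trans (expect_diff_bad _ _ w (ltW t0) nf fL)); rewrite lerDr.
  by case: mErr.
apply: (le_trans mean); rewrite addr0 lee_fin.
have dl_le i j : (i <= j)%N -> dl ^+ j <= dl ^+ i.
  by move=> ij; apply: ler_wiXn2l => //; exact: ltW.
have sn0 : 0 < Num.sqrt n%:R :> R by rewrite sqrtr_gt0.
have isn : (Num.sqrt n%:R)^-1 <= dl ^+ 4.
  rewrite -(@ler_sqr _ _ (dl ^+ 4)) ?nnegrE ?invr_ge0 ?exprn_ge0 ?(ltW dl0)//.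
  by rewrite exprVn sqr_sqrtr ?(ltW nR)// ndl -exprM; exact: dl_le.
have hM2 : M2 / Num.sqrt n%:R <= 4 * (L * p).
  apply: (le_trans (ler_wpM2l (ltW M20) isn)).
  have -> : M2 * dl ^+ 4 = 4 * (L * p) * dl ^+ 2 by rewrite /M2; field; exact: lt0r_neq0.
  apply: ler_piMr; first by apply: mulr_ge0; rewrite ?ler0n ?(ltW Lp0).
  by rewrite -[leRHS](expr0 dl) dl_le.
have hM4 : M4 / Num.sqrt n%:R <= 16 * (L * p).
  apply: (le_trans (ler_wpM2l (ltW M40) isn)).
  by rewrite le_eqVlt; apply/orP; left; apply/eqP; rewrite /M4; field; exact: lt0r_neq0.
have hM3 : M3 / n%:R <= 8 * (L * p).
  rewrite ndl.
  have -> : M3 * dl ^+ 11 = 8 * (L * p) * dl ^+ 8 by rewrite /M3; field; exact: lt0r_neq0.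
  apply: ler_piMr; first by apply: mulr_ge0; rewrite ?ler0n ?(ltW Lp0).
  by rewrite -[leRHS](expr0 dl) dl_le.
have hn : n%:R^-1 `^ kappa <= p.
  rewrite ndl; apply: ge0_ler_powR; rewrite ?nnegrE ?exprn_ge0 ?(ltW k0) ?(ltW dl0)//.
  by rewrite -[leRHS](expr1 dl) dl_le.
have hs : \sum_(j < k) 40 * (2 * h * M4) / Num.sqrt n%:R = 80 * t * (M4 / Num.sqrt n%:R).
  rewrite sumr_const card_ord -[LHS]mulr_natr -kh; ring.
have w1 : wt * (40 * M2 / Num.sqrt n%:R + 40 * M2 / Num.sqrt n%:R +
    \sum_(j < k) 40 * (2 * h * M4) / Num.sqrt n%:R) <=
    wt * ((320 + 1280 * t) * (L * p)).
  apply: ler_wpM2l => //; rewrite hs.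
  have e80 : 0 <= 80 * t by apply: mulr_ge0; [exact: ler0n|exact: ltW].
  have := ler_wpM2l e80 hM4.
  have -> : 80 * t * (16 * (L * p)) = 1280 * t * (L * p) by ring.
  have -> : 40 * M2 / Num.sqrt n%:R = 40 * (M2 / Num.sqrt n%:R) by ring.
  rewrite [X in _ -> is_true (_ <= X)](_ : _ = 320 * (L * p) + 1280 * t * (L * p)); last by ring.
  move: (M4 / _) hM2; set u := M2 / _; set y := L * p.
  move=> x1 ux hx; apply: lerD => //; move: ux; lra.
have w2 : 2 * t * M3 * n%:R^-1 <= 16 * t * (L * p).
  have e2 : 0 <= 2 * t by rewrite mulr_ge0// ltW.
  rewrite -mulrA; apply: (le_trans (ler_wpM2l e2 hM3)).
  by rewrite le_eqVlt; apply/orP; left; apply/eqP; ring.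
have w3 : 2 * L * n%:R^-1 `^ kappa <= 2 * (L * p).
  by rewrite -mulrA; do 2 (apply: ler_wpM2l; rewrite ?(ltW L0)//).
have -> : (21 + 16 * t + (1 + (K + 1) ^+ 2 + 662 * t) * (320 + 1280 * t)) * L * p =
  L * p + 16 * (L * p) + 2 * (L * p) + L * p + 16 * t * (L * p) + L * p +
  wt * ((320 + 1280 * t) * (L * p)) by rewrite /wt /A; ring.
apply: lerD => //.
have -> : det + t * (132 * M2 / rho) * (20 * N%:R / n%:R) =
  2 * (L * (z / r1 ^+ 2)) + 2 * (4 * (2 * L) * p) + 2 * L * n%:R^-1 `^ kappa +
  t * (3 * h * M4 + 4 * r * M3) + 2 * t * M3 * n%:R^-1 +
  (t * (3 * B ^+ 2 / rho ^+ 2 * M2) + t * (132 * M2 / rho) * (20 * N%:R / n%:R)).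
  by rewrite /det addrA.
do 4 (apply: lerD => //).
by apply: lerD => //; rewrite le_eqVlt; apply/orP; left; apply/eqP; ring.
Qed.

End quantitative.

(** * The rate of convergence *)

Lemma BLnorm_bounds (R : realType) (kappa : R) (f : R -> R) : BL kappa f ->
  [/\ BLnorm kappa f = (fine (BLnorm kappa f))%:E, 0 <= fine (BLnorm kappa f),
    forall y, `|f y| <= fine (BLnorm kappa f) & holder (fine (BLnorm kappa f)) kappa f].
Proof.
rewrite /BL/=; set s1 := ereal_sup [set `|f x|%:E | x in [set: R]].
set s2 := ereal_sup [set (`|f p.1 - f p.2| / `|p.1 - p.2| `^ kappa)%:E |
               p in [set p : R * R | p.1 != p.2]].
rewrite -[BLnorm kappa f]/(s1 + s2)%E.
have h1 x : (`|f x|%:E <= s1)%E by apply: ereal_sup_ubound; exists x.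
have h2 x y : x != y -> ((`|f x - f y| / `|x - y| `^ kappa)%:E <= s2)%E.
  by move=> xy; apply: ereal_sup_ubound; exists (x, y).
have s10 : (0 <= s1)%E by apply: le_trans (h1 0); rewrite lee_fin.
have s20 : (0 <= s2)%E.
  by apply: le_trans (h2 0 1 _); rewrite ?lee_fin ?divr_ge0 ?powR_ge0// eq_sym oner_neq0.
move=> fin.
have sfin : (s1 + s2)%E \is a fin_num by rewrite ge0_fin_numE// adde_ge0.
have e := fineK sfin; split => //.
- exact: fine_ge0 (adde_ge0 s10 s20).
- by move=> y; rewrite -lee_fin e (le_trans (h1 y))// leeDl.
- move=> x y; have [->|xy] := eqVneq x y.
    by rewrite subrr normr0 mulr_ge0 ?powR_ge0// fine_ge0// adde_ge0.
  rewrite -ler_pdivrMr ?powR_gt0 ?normr_gt0 ?subr_eq0//.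
  by rewrite -lee_fin e (le_trans (h2 x y xy))// leeDr.
Qed.

Theorem theorem8p23 (R : realType) (alpha kappa t K E : R)
  (halpha : 1 < alpha) (hkappa : 1 / 2 < kappa) (hkappa1 : kappa <= 1)
  (hak : kappa / (3 * kappa + 4) + 5 * kappa + 7 / 2 < alpha)
  (ht : 0 < t) (hK : 0 < K) (hE : E < kappa / (2 * (3 * kappa + 4))) :
  exists C : R, 0 < C /\
  forall (d : measure_display) (Omega : measurableType d)
    (P : probability Omega R) (tau : int -> {RV P >-> R})
    (X : markov_process [set: R])
    (Xn : forall n : nat, Omega -> markov_process (lattice R n)),
  iid_pareto alpha tau ->
  is_diffusion (fine 'E_P[tau 0])^-1 X ->
  (forall (n : nat) (w : Omega), (0 < n)%N -> (forall x, 0 < tau x w) ->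
     is_trap_chain (fun x => tau x w) (Xn n w)) ->
  forall (n : nat) (f : R -> R), (0 < n)%N -> BL kappa f ->
  (\int[P]_w ereal_sup
     [set `| mp_expect X x t f -
             mp_expect (Xn n w) ((Num.floor (n%:R * x))%:~R / n%:R) t f |
       | x in [set x : R | (`|x| <= K)%R] ]
   <= C%:E * BLnorm kappa f * (n%:R `^ (- E))%:E)%E.
Proof.
pose C := 21 + 16 * t + (1 + (K + 1) ^+ 2 + 662 * t) * (320 + 1280 * t).
have p0 (m : nat) : 0 <= m%:R * t by rewrite mulr_ge0 ?ler0n// ltW.
have C0 : 0 < C.
  apply: ltr_wpDr; last by apply: ltr_wpDr; [exact: p0|rewrite ltr0n].
  apply: mulr_ge0; last by apply: addr_ge0; [exact: ler0n|exact: p0].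
  by apply: addr_ge0; [apply: addr_ge0 => //; exact: sqr_ge0|exact: p0].
have k0 : 0 < kappa by apply: lt_trans hkappa; rewrite divr_gt0.
have alpha3 : 3 <= alpha.
  have q0 : 0 < kappa / (3 * kappa + 4) by rewrite divr_gt0// addr_gt0// mulr_gt0.
  by move: hkappa hak q0; move: (kappa / _) => q; lra.
exists C; split=> // d Omega P tau X Xn ipar diffX chainX n f n0 BLf.
have [-> L0 fL hf] := BLnorm_bounds BLf; set L := fine _ in L0 fL hf *.
have n1 : 1 <= n%:R :> R by rewrite ler1n.
have nR : 0 < n%:R :> R by rewrite ltr0n.
pose dl : R := n%:R `^ (- 11^-1).
have dl0 : 0 < dl by exact: powR_gt0.
have dl1 : dl <= 1.
  by rewrite -(powRr0 n%:R) ler_powR// oppr_le0 invr_ge0 ler0n.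
have ndl : n%:R^-1 = dl ^+ 11.
  rewrite -powR_mulrn ?(ltW dl0)// -powRrM mulNr mulVf ?pnatr_eq0//.
  by rewrite powR_inv1// ltW.
(* This is [kappa / (2 * (3 * kappa + 4)) <= kappa / 11]. *)
have rate : dl `^ kappa <= n%:R `^ (- E).
  rewrite -powRrM; apply: ler_powR => //.
  rewrite mulNr lerN2 mulrC (le_trans (ltW hE))//.
  rewrite ler_pM2l// lef_pV2 ?posrE ?mulr_gt0 ?addr_gt0 ?mulr_gt0 ?ltr0n//.
  by move: hkappa; lra.
have nE0 : 0 < n%:R `^ (- E) :> R by exact: powR_gt0.
rewrite -!EFinM; apply/lee_addgt0Pr => e e0; rewrite -EFinD.
(* Slightly more than the norm of [f], which may vanish. *)
pose L' := L + e / (C * n%:R `^ (- E)).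
have LL' : L < L' by rewrite ltrDl divr_gt0// mulr_gt0.
have L'0 : 0 < L' by exact: le_lt_trans LL'.
have := @sup_expect_mean _ alpha d Omega P tau X n (Xn n) alpha3 ipar n0 diffX
  (fun w => chainX n w n0) L' kappa t K dl f ht hK L'0 k0 hkappa1 _ _ dl0 dl1 ndl.
move=> /(_ _ _)/le_trans; apply.
- by move=> y; exact: le_trans (fL y) (ltW LL').
- move=> x y; apply: (le_trans (hf x y)); apply: ler_wpM2r; first exact: powR_ge0.
  exact: ltW.
rewrite lee_fin -/C.
apply: (@le_trans _ _ (C * L' * n%:R `^ (- E))).
  by apply: ler_wpM2l => //; apply: mulr_ge0; exact: ltW.
have key (u v : R) : u != 0 -> v != 0 -> u * (L + e / (u * v)) * v = u * L * v + e.
  by move=> u0 v0; field; rewrite u0 v0.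
by rewrite key ?lt0r_neq0.
Qed.
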